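(* Up to isomorphism, there exists a unique real form, with compact underlying reduced group, of the SUSY $2$-supergroup $\mathrm{SL}(1|1)$, and it is obtained with an involution $\sigma=c\circ\phi$, where $\phi$ is a SUSY preserving automorphism of $\mathrm{SL}(1|1)$ and $c$ is a complex conjugation. Explicitly, in functor of points notation, $$\sigma\begin{pmatrix} a & \beta\\ \gamma & d\end{pmatrix}=\begin{pmatrix}\overline{d}^{\,-1} & -i\,\overline{a}^{\,-2}\,\overline{\gamma}\\ -i\,\overline{a}^{\,-2}\,\overline{\beta} & \overline{a}^{\,-1}\end{pmatrix}.$$
   Context: $\mathrm{SL}(1|1)$ is the complex Lie supergroup of dimension $1|2$ whose functor of points is $$\mathrm{SL}(1|1)(T)=\left\{\begin{pmatrix} a&\beta\\ \gamma& d\end{pmatrix}\ :\ a,d\in\mathcal{O}(T)_0^\times,\ \beta,\gamma\in\mathcal{O}(T)_1,\ d^{-1}(a-\beta d^{-1}\gamma)=1\right\}.$$ Its Lie superalgebra $\mathfrak{sl}(1|1)$ has basis $C$ (even), $E,F$ (odd), with $[E,F]=C$ and all other brackets of basis elements zero. A SUSY $2$-curve is a complex supermanifold $X$ of dimension $1|2$ with two distributions $\mathcal{D}_1,\mathcal{D}_2$ of rank $0|1$ such that $[\mathcal{D}_i,\mathcal{D}_i]\subset\mathcal{D}_i$ and the Frobenius map $\mathcal{D}_1\otimes\mathcal{D}_2\to TX/(\mathcal{D}_1\oplus\mathcal{D}_2)$ induced by the bracket is an isomorphism; a SUSY $2$-supergroup is a SUSY $2$-curve that is also a complex Lie supergroup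 with $\mathcal{D}_1,\mathcal{D}_2$ left invariant. $\mathrm{SL}(1|1)$ is a SUSY $2$-supergroup with the left invariant distributions generated by $E$ and by $F$. A SUSY preserving automorphism of a SUSY $2$-supergroup $X$ is a supergroup automorphism $\phi:X\to X$ with $\phi_*(\mathcal{D}_i)=\mathcal{D}_j$, i.e. $\phi$ preserves each distribution individually or exchanges the two. A real form of a complex Lie supergroup is a real Lie supergroup obtained as the fixed points of an involutive antiholomorphic supergroup automorphism $\sigma$ (equivalently, in terms of super Harish-Chandra pairs, a real form of the underlying complex Lie group together with a compatible real form of the Lie superalgebra). In the formula the bar denotes complex conjugation of functions, with $\overline{xy}=\overline{x}\,\overline{y}$.
   Formalization: Uniqueness is stated only for real forms σ=c∘φ whose automorphism φ exchanges the two distributions; among all compact real forms it fails, since one with φ fixing both distributions is not isomorphic to the displayed one. *)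

(* Defs.v *)
From HB Require Import structures.
From mathcomp Require Import all_boot all_order all_algebra.
From mathcomp Require Import complex.
From mathcomp Require Import all_classical all_reals all_analysis.

Set Implicit Arguments.
Unset Strict Implicit.
Unset Printing Implicit Defensive.

Import Order.TTheory GRing.Theory Num.Theory.
Import numFieldNormedType.Exports.

Local Open Scope classical_set_scope.
Local Open Scope ring_scope.

(* [par false] and [par true] are the even and the odd part.  The sign rule
   includes t * t = 0 for odd t, since 2 is invertible in the intended K. *)
Record superalgebra (K : fieldType) := Superalgebra {
  superalgebra_sort :> unitAlgType K;
  par : bool -> {pred superalgebra_sort};
  par_submod : forall e, submod_closed (par e);
  par_decomp : forall x, exists x0 x1,
    [/\ x0 \in par false, x1 \in par true & x = x0 + x1];
  par_direct : forall x, x \in par false -> x \in par true -> x = 0;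
  par_one : 1 \in par false;
  par_mul : forall e e' x y,
    x \in par e -> y \in par e' -> x * y \in par (e (+) e');
  par_comm : forall e e' x y,
    x \in par e -> y \in par e' -> x * y = (-1) ^+ (e && e') * (y * x)
}.

Section Matrices.
Variable A : pzRingType.

Definition mx22 (a b c d : A) : 'M[A]_2 :=
  \matrix_(i, j) if i == 0 then (if j == 0 then a else b)
                 else (if j == 0 then c else d).

(* The root vectors E (at [false]) and F (at [true]) of sl(1|1). *)
Definition rootvec (i : bool) : 'M[A]_2 :=
  if i then mx22 0 0 1 0 else mx22 0 1 0 0.

End Matrices.

(* The functor of points of SL(1|1). *)
Definition SL11 (K : fieldType) (A : superalgebra K) (g : 'M[A]_2) : Prop :=
  let: a := g 0 0 in let: b := g 0 1 in let: c := g 1 0 in let: d := g 1 1 in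
  [/\ a \in par false /\ a \is a GRing.unit,
      d \in par false /\ d \is a GRing.unit,
      b \in par true,
      c \in par true
    & d^-1 * (a - b * d^-1 * c) = 1].

Section SuperLieGroup.
Variable R : realType.
(* The regular algebra R[i]^o is R[i] itself, with its topology. *)
Local Notation C := (R[i]^o).

(* The algebra of functions O(T) of a superpoint T, i.e. a super Weil algebra:
   a local supercommutative superalgebra with residue field C and nilpotent
   maximal ideal.  A morphism of supermanifolds is determined by its action on
   superpoint-valued points. *)
Record superpoint := Superpoint {
  superpoint_sort :> superalgebra R[i];
  body : {lrmorphism superpoint_sort -> C};
  nil_order : nat;
  body_nil : forall x, body x = 0 -> x ^+ nil_order = 0
}.

(* The algebra of complex-valued functions O(T) of a real superpoint T; [bar]
   is complex conjugation of functions, without a sign or an exchange of the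
   factors on products of odd elements. *)
Record real_superpoint := RealSuperpoint {
  real_superpoint_sort :> superpoint;
  bar : {rmorphism real_superpoint_sort -> real_superpoint_sort};
  bar_scale : forall (k : R[i]) x, bar (k *: x) = k^*%C *: bar x;
  bar_invol : forall x, bar (bar x) = x;
  bar_par : forall e x, x \in par e -> bar x \in par e
}.

(* Holomorphic functions on C^*, extended arbitrarily by some value at 0.
   Existence of all complex derivatives is, by Cauchy's theorem, the same as
   existence of the first one; the higher ones occur in [taylor]. *)
Definition holomorphic (f : C -> C) : Prop :=
  forall (n : nat) (z : C), z != 0 -> derivable (derive1n n f) z 1.

(* The value f(x) at an even element x: Taylor expansion at the body of x. *)
Definition taylor (A : superpoint) (f : C -> C) (x : A) : A :=
  \sum_(k < nil_order A)
    ((derive1n k f (body A x) / k`!%:R : R[i]) *: (x - (body A x : R[i])%:A) ^+ k).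

(* Global superfunctions on SL(1|1).  The entry a = d + beta d^-1 gamma is
   determined by the other three, so (d | beta, gamma) are global coordinates
   which identify SL(1|1) with C^* x C^{0|2}. *)
Definition superfunction (F : forall A : superpoint, 'M[A]_2 -> A) : Prop :=
  exists f0 f1 f2 f12 : C -> C,
    [/\ holomorphic f0, holomorphic f1, holomorphic f2, holomorphic f12
      & forall (A : superpoint) (g : 'M[A]_2), SL11 g ->
          F A g = taylor f0 (g 1 1) + taylor f1 (g 1 1) * g 0 1
                  + taylor f2 (g 1 1) * g 1 0
                  + taylor f12 (g 1 1) * (g 0 1 * g 1 0)].

(* Transformations of the functor of points; only their values on SL11 matter.
   Naturality is part of [holomorphic_map] (resp. [antiholomorphic_map]). *)
Definition transf := forall A : superpoint, 'M[A]_2 -> 'M[A]_2.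
Definition real_transf := forall A : real_superpoint, 'M[A]_2 -> 'M[A]_2.

(* A morphism of complex supermanifolds from SL(1|1) to itself is an
   O(SL(1|1))-valued point of SL(1|1). *)
Definition holomorphic_map (phi : transf) : Prop :=
  (forall A g, SL11 g -> SL11 (phi A g)) /\
  (forall i j, superfunction (fun A g => phi A g i j)).

Definition holomorphic_automorphism (phi : transf) : Prop :=
  [/\ holomorphic_map phi,
      forall A g h, SL11 g -> SL11 h -> phi A (g *m h) = phi A g *m phi A h
    & exists2 psi : transf, holomorphic_map psi &
        forall A g, SL11 g -> psi A (phi A g) = g /\ phi A (psi A g) = g].

(* The complex conjugation c of SL(1|1). *)
Definition cconj (A : real_superpoint) (g : 'M[A]_2) : 'M[A]_2 :=
  map_mx (bar A) g.

(* sigma = c o phi *)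
Definition conj_comp (phi : transf) (sigma : real_transf) : Prop :=
  forall (A : real_superpoint) (g : 'M[A]_2), SL11 g ->
    sigma A g = cconj (phi A g).

(* Antiholomorphic: the complex conjugate is holomorphic. *)
Definition antiholomorphic_map (sigma : real_transf) : Prop :=
  exists2 phi : transf, holomorphic_map phi & conj_comp phi sigma.

(* Involutive antiholomorphic supergroup automorphism. *)
Definition real_structure (sigma : real_transf) : Prop :=
  [/\ antiholomorphic_map sigma,
      forall A g h, SL11 g -> SL11 h ->
        sigma A (g *m h) = sigma A g *m sigma A h
    & forall A g, SL11 g -> sigma A (sigma A g) = g].

(* The fixed points of sigma, as a functor on real superpoints. *)
Definition real_form (sigma : real_transf) (A : real_superpoint) :
    set 'M[A]_2 :=
  [set g | SL11 g /\ sigma A g = g].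

(* phi_*(D_i) = D_j, where D_i is the left invariant distribution generated by
   [rootvec i].  At a T-point g the fibre of D_i consists of the odd tangent
   directions g * (1 + t X_i), t odd, where 1 + t X_i = exp (t X_i) as
   t * t = 0; the differential of phi has to map this fibre onto the one of D_j
   at phi g, i.e. the generator X_i to an invertible multiple h X_j. *)
Definition pushes (phi : transf) (i j : bool) : Prop :=
  forall (A : superpoint) (g : 'M[A]_2), SL11 g ->
    exists h : A, [/\ h \in par false, h \is a GRing.unit &
      forall t : A, t \in par true ->
        phi A (g *m (1%:M + t *: rootvec A i)) =
        phi A g *m (1%:M + (t * h) *: rootvec A j)].

(* The distinction matters for real forms with compact reduced group.  Besides
   the ones whose theta = c o sigma exchanges D_1 and D_2 there are ones whose
   theta fixes both, e.g. a, beta, gamma, d |-> bar a^-1, bar d^-2 bar beta,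
   - bar d^-2 bar gamma, bar d^-1.  Their real Lie superalgebras differ: the
   bracket on the odd part is a definite quadratic form in the first case and
   a hyperbolic one in the second. *)
Definition susy_fixing (phi : transf) : Prop := forall i, pushes phi i i.
Definition susy_exchanging (phi : transf) : Prop := forall i, pushes phi i (~~ i).

Definition susy_preserving (phi : transf) : Prop :=
  susy_fixing phi \/ susy_exchanging phi.

(* Isomorphism of real forms of the SUSY 2-supergroup: the complexification
   psi of an isomorphism of the fixed point supergroups is an automorphism of
   SL(1|1) which intertwines the two real structures. *)
Definition isomorphic_real_forms (sigma tau : real_transf) : Prop :=
  exists psi : transf,
    [/\ holomorphic_automorphism psi, susy_preserving psi
      & forall (A : real_superpoint) (g : 'M[A]_2), SL11 g ->
          psi A (sigma A g) = tau A (psi A g)].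

End SuperLieGroup.

(* The ordinary point, O(pt) = C: its points are those of the reduced group. *)
Section OrdinaryPoint.
Variable R : realType.
Local Notation C := (R[i]^o).

Definition pt_par (e : bool) : {pred C} := fun x => e ==> (x == 0).

Fact pt_par_submod e : submod_closed (pt_par e).
Proof.
split; first by rewrite unfold_in; case: e => //=.
move=> k x y; rewrite !unfold_in; case: e => //= /eqP-> /eqP->.
by rewrite scaler0 addr0.
Qed.

Fact pt_par_decomp (x : C) : exists x0 x1,
  [/\ x0 \in pt_par false, x1 \in pt_par true & x = x0 + x1].
Proof. by exists x, 0; rewrite !unfold_in /= addr0. Qed.

Fact pt_par_direct (x : C) : x \in pt_par false -> x \in pt_par true -> x = 0.
Proof. by rewrite !unfold_in /= => _ /eqP. Qed.

Fact pt_par_one : 1 \in pt_par false. Proof. by []. Qed.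

Fact pt_par_mul e e' (x y : C) :
  x \in pt_par e -> y \in pt_par e' -> x * y \in pt_par (e (+) e').
Proof.
rewrite !unfold_in; case: e e' => [] [] //=.
- by move=> /eqP-> _; rewrite mul0r.
- by move=> _ /eqP->; rewrite mulr0.
Qed.

Fact pt_par_comm e e' (x y : C) : x \in pt_par e -> y \in pt_par e' ->
  x * y = (-1) ^+ (e && e') * (y * x).
Proof.
rewrite !unfold_in; case: e e' => [] [] //=; rewrite ?expr0 ?mul1r 1?mulrC //.
by move=> /eqP-> _; rewrite !mulr0.
Qed.

Definition pt_superalgebra : superalgebra R[i] :=
  Superalgebra pt_par_submod pt_par_decomp pt_par_direct pt_par_one
    pt_par_mul pt_par_comm.

Definition pt_body : {lrmorphism pt_superalgebra -> C} := idfun.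

Fact pt_body_nil (x : pt_superalgebra) : pt_body x = 0 -> x ^+ 1 = 0.
Proof. by []. Qed.

Definition pt_superpoint : superpoint R := Superpoint pt_body_nil.

Definition pt_bar : {rmorphism pt_superpoint -> pt_superpoint} :=
  (@conjc R : {rmorphism R[i] -> R[i]}).

Fact pt_bar_scale (k : R[i]) (x : pt_superpoint) :
  pt_bar (k *: x) = k^*%C *: pt_bar x.
Proof. exact: (rmorphM (@conjc R)). Qed.

Fact pt_bar_invol (x : pt_superpoint) : pt_bar (pt_bar x) = x.
Proof. exact: conjcK. Qed.

Fact pt_bar_par e (x : pt_superpoint) : x \in par e -> pt_bar x \in par e.
Proof.
by rewrite !unfold_in; case: e => //= /eqP->; rewrite rmorph0.
Qed.

Definition pt : real_superpoint R :=
  RealSuperpoint pt_bar_scale pt_bar_invol pt_bar_par.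

(* The underlying reduced group of the real form, as a subspace of 'M[C]_2. *)
Definition reduced_real_form (sigma : real_transf R) : set 'M[C]_2 :=
  real_form sigma (A := pt).

End OrdinaryPoint.

(* Main.v *)
(* In the coordinates g = d exp(b E) exp(c F) the product is
   (d, b, c)(d', b', c') = (d d' (1 + c b'), b + b', c + c'), sigma maps (d, b, c)
   to the conjugate of (1/d (1 - b c), i c, i b), and an exchanging automorphism theta
   is determined by theta(d), theta(exp(t E)) = exp(la t F) and
   theta(exp(t F)) = exp(mu t E).

   Uniqueness.  On the centre C^* theta is a holomorphic homomorphism chi.  As
   z conj(chi z) is fixed by the real structure, compactness bounds all its powers,
   so z chi(z) has modulus 1.  By holomorphy its derivative at 1 vanishes, hence
   it is constant and chi(z) = 1/z.  The commutator of exp(t E) and exp(s F), at a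
   point with t s <> 0, gives la mu = -1, and the involution property gives
   conj(mu) la = 1; thus mu = i m with m real, and rescaling E and F, combined
   with d |-> 1/d if m < 0, reduces to m = 1. *)

Require Import Defs.
From HB Require Import structures.
From mathcomp Require Import all_boot all_order all_algebra.
From mathcomp Require Import complex.
From mathcomp Require Import all_classical all_reals all_analysis.
From mathcomp Require Import ring lra.

Set Implicit Arguments.
Unset Strict Implicit.
Unset Printing Implicit Defensive.

Import Order.TTheory GRing.Theory Num.Theory.
Import numFieldNormedType.Exports.

Local Open Scope classical_set_scope.
Local Open Scope ring_scope.

(** A transformation is given separately at every superpoint. What makes [chi], [la] and [mu]
    independent of the superpoint is the expansion of its entries as superfunctions, whose
    coefficients are shared by all superpoints. So [chi] is determined at the ordinary point, the
    only place where compactness speaks, and is carried to nilpotent thickenings by Taylor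
    expansion; [la] and [mu] are values at [d = 1] of expansion coefficients. The relation between
    them cannot be seen at the ordinary point, which has no odd elements, hence the Grassmann
    algebra on two generators.

    The rigidity of [z * chi z] uses only its linear approximation at 1: if the derivative were
    [l != 0], moving in the direction of the conjugate of [l] would increase the modulus to first
    order. The homomorphism property then spreads the vanishing derivative from 1 to the other
    points.

    A rescaling of [E] by [p] and [F] by [p^-1] changes [m] only by the positive factor [|p|^2]. The
    sign of [m] can therefore be corrected only by an automorphism that inverts the centre and so
    sends [C] to [-C]. *)

Section Matrix22.
Variable A : pzRingType.
Implicit Types (a b c d : A) (g : 'M[A]_2).

Lemma mx22_inj a b c d a' b' c' d' : mx22 a b c d = mx22 a' b' c' d' ->
  [/\ a = a', b = b', c = c' & d = d'].
Proof.
move=> e; have h i j : mx22 a b c d i j = mx22 a' b' c' d' i j by rewrite e.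
by move: (h 0 0) (h 0 1) (h 1 0) (h 1 1); rewrite !mxE.
Qed.

Lemma ord2_ind (P : 'I_2 -> Prop) : P 0 -> P 1 -> forall i, P i.
Proof.
move=> P0 P1 [[|[|i]] hi] //.
  by rewrite (_ : Ordinal hi = 0) //; apply: val_inj.
by rewrite (_ : Ordinal hi = 1) //; apply: val_inj.
Qed.

Lemma mx22_ext g g' : g 0 0 = g' 0 0 -> g 0 1 = g' 0 1 ->
  g 1 0 = g' 1 0 -> g 1 1 = g' 1 1 -> g = g'.
Proof.
by move=> e00 e01 e10 e11; apply/matrixP; apply: ord2_ind; apply: ord2_ind.
Qed.

Lemma mx22_mul a b c d a' b' c' d' : mx22 a b c d *m mx22 a' b' c' d' =
  mx22 (a * a' + b * c') (a * b' + b * d') (c * a' + d * c') (c * b' + d * d').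
Proof. by apply: mx22_ext; rewrite !mxE !big_ord_recr big_ord0 /= !mxE add0r. Qed.

Lemma mx22_scalar a : a%:M = mx22 a 0 0 a.
Proof. by apply: mx22_ext; rewrite !mxE. Qed.

End Matrix22.

(** * Parity calculus and coordinates on SL(1|1) *)

Section Superalgebra.
Variables (K : numFieldType) (A : superalgebra K).
Implicit Types (x y : A).

Lemma par0 e : (0 : A) \in par e.
Proof. by have [] := @par_submod K A e. Qed.

Lemma parD e x y : x \in par e -> y \in par e -> x + y \in par e.
Proof.
move=> px py; have [_ h] := @par_submod K A e.
by rewrite -[x]scale1r h.
Qed.

Lemma parZ e k x : x \in par e -> k *: x \in par e.
Proof.
move=> px; have [_ h] := @par_submod K A e.
by rewrite -[_ *: _]addr0 h // par0.
Qed.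

Lemma parN e x : x \in par e -> - x \in par e.
Proof. by move=> px; rewrite -scaleN1r parZ. Qed.

Lemma par_even x e y : x \in par false -> y \in par e -> x * y \in par e.
Proof. by move=> px py; have := par_mul px py. Qed.

Lemma par_oddM x y : x \in par true -> y \in par true -> x * y \in par false.
Proof. by move=> px py; have := par_mul px py. Qed.

Lemma par_commr x y : x \in par false -> y * x = x * y.
Proof.
move=> px; have [y0 [y1 [p0 p1 ->]]] := par_decomp y.
have h e z : z \in par e -> z * x = x * z.
  by move=> pz; rewrite (par_comm px pz) mul1r.
by rewrite mulrDl mulrDr (h _ _ p0) (h _ _ p1).
Qed.

Lemma par_oddC x y : x \in par true -> y \in par true -> x * y = - (y * x).
Proof. by move=> px py; rewrite (par_comm px py) mulN1r. Qed.

Lemma par_oddxx x : x \in par true -> x * x = 0.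
Proof.
move=> px; have /eqP := par_oddC px px.
rewrite -addr_eq0 -mulr2n -scaler_nat => /eqP e.
have two0 : (2%:R : K) != 0 by rewrite pnatr_eq0.
by rewrite -[x * x]scale1r -(mulVf two0) -scalerA e scaler0.
Qed.

(** If [y0] and [y1] are the even and odd parts of the inverse, then [x * y1] is odd, and as
    [1 - x * y0] it is also even. *)
Lemma par_evenV x : x \in par false -> x \is a GRing.unit -> x^-1 \in par false.
Proof.
move=> px ux; have [y0 [y1 [p0 p1 e]]] := par_decomp x^-1.
suff y10 : y1 = 0 by rewrite e y10 addr0.
apply: (mulrI ux); rewrite mulr0; apply: par_direct; last exact: par_even.
have -> : x * y1 = 1 - x * y0.
  by rewrite -(divrr ux) e mulrDr addrC addKr.
by rewrite parD ?par_one // parN // par_even.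
Qed.

End Superalgebra.

(* d exp (b E) exp (c F), where d is a scalar matrix. *)
Definition slmx (A : pzRingType) (d b c : A) : 'M[A]_2 :=
  mx22 (d * (1 + b * c)) (d * b) (d * c) d.

Section Coordinates.
Variables (K : numFieldType) (A : superalgebra K).
Implicit Types (b c d : A) (g : 'M[A]_2).

Definition coords d b c : Prop :=
  [/\ d \in par false, d \is a GRing.unit, b \in par true & c \in par true].

Lemma odd_unit1D b c : b \in par true -> c \in par true ->
  (1 + b * c) * (1 - b * c) = 1.
Proof.
move=> pb pc; rewrite mulrBr mulr1 mulrDl mul1r.
have -> : b * c * (b * c) = 0.
  by rewrite mulrA -(mulrA b) (par_oddC pc pb) mulrN mulrA par_oddxx // mul0r oppr0 mul0r.
by rewrite addr0 addrK.
Qed.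

Lemma odd_unit1B b c : b \in par true -> c \in par true ->
  (1 - b * c) * (1 + b * c) = 1.
Proof. by move=> pb pc; have := odd_unit1D (parN pb) pc; rewrite !mulNr opprK. Qed.

Lemma unit_odd1D b c : b \in par true -> c \in par true ->
  1 + b * c \is a GRing.unit.
Proof.
move=> pb pc; apply/unitrP; exists (1 - b * c).
by rewrite odd_unit1D // odd_unit1B.
Qed.

Lemma odd1DV b c : b \in par true -> c \in par true ->
  (1 + b * c)^-1 = 1 - b * c.
Proof.
move=> pb pc; apply: (mulrI (unit_odd1D pb pc)).
by rewrite odd_unit1D // divrr // unit_odd1D.
Qed.

Lemma par_odd1D b c : b \in par true -> c \in par true ->
  1 + b * c \in par false.
Proof. by move=> pb pc; rewrite parD ?par_one // par_oddM. Qed.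

Lemma SL11_coords d b c : coords d b c -> SL11 (slmx d b c).
Proof.
case=> pd ud pb pc; have p1 := par_odd1D pb pc; rewrite /SL11 !mxE /=; split=> //.
- by rewrite par_even // unitrMl // unit_odd1D.
- exact: par_even.
- exact: par_even.
by rewrite -(mulrA (d * b)) mulKr // [d * (1 + _)]mulrDr mulr1 (mulrA d b c) addrK mulVr.
Qed.

(** The Berezinian condition solves for the upper left entry, [a = d + beta d^-1 gamma]; for
    [b = d^-1 beta] and [c = d^-1 gamma] this is [d (1 + b c)]. *)
Lemma coordsP g : SL11 g -> exists d b c, coords d b c /\ g = slmx d b c.
Proof.
case=> [[pa ua] [pd ud] pb pc e].
exists (g 1 1), ((g 1 1)^-1 * g 0 1), ((g 1 1)^-1 * g 1 0).
have pV := par_evenV pd ud.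
split; first by split=> //; exact: par_even.
apply: mx22_ext; rewrite !mxE /= ?mulVKr //.
have {e}/eqP : g 0 0 - g 0 1 * (g 1 1)^-1 * g 1 0 = g 1 1.
  by rewrite -[LHS](mulKr ud) -[in RHS](mulr1 (g 1 1)) -e; rewrite mulVKr ?mulKr.
rewrite subr_eq => /eqP ->; rewrite mulrDr mulr1; congr (_ + _).
by rewrite !mulrA mulrV // mul1r.
Qed.

Lemma slmx_inj d b c d' b' c' : d \is a GRing.unit ->
  slmx d b c = slmx d' b' c' -> [/\ d = d', b = b' & c = c'].
Proof.
move=> ud /mx22_inj[_ eb ec ed]; rewrite -ed in eb ec *.
by split=> //; apply: (mulrI ud).
Qed.

Lemma slmx_mul d b c d' b' c' : d \in par false -> d' \in par false ->
  b \in par true -> c \in par true -> b' \in par true -> c' \in par true ->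
  slmx d b c *m slmx d' b' c' = slmx (d * d' * (1 + c * b')) (b + b') (c + c').
Proof.
move=> pd pd' pb pc pb' pc'.
have mv x y : d * x * (d' * y) = d * d' * (x * y).
  by rewrite mulrA -(mulrA d) (par_commr x pd') !mulrA.
have mv1 x : d * x * d' = d * d' * x by rewrite -(mulr1 d') mv !mulr1.
have mv2 y : d * (d' * y) = d * d' * y by rewrite mulrA.
have cb : c * b' = - (b' * c) by rewrite par_oddC.
have cbb : c * b' * b = b * c * b'.
  by rewrite -mulrA (par_oddC pb' pb) mulrN mulrA (par_oddC pc pb) mulNr opprK.
have cbb' : c * b' * b' = 0 by rewrite -mulrA par_oddxx // mulr0.
have cbc : c * b' * c = 0.
  by rewrite -mulrA (par_oddC pb' pc) mulrN mulrA par_oddxx // mul0r oppr0.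
(* With [d * d'] factored out only words in odd letters remain. Words with a repeated letter vanish,
   and in the upper left entry the correction [c * b'] cancels [b' * c] from
   [(b + b') * (c + c')]. *)
rewrite /slmx mx22_mul !mv !mv1 !mv2 -!mulrDr; congr mx22; rewrite -?(mulrA (d * d')).
- congr (_ * _); rewrite [(b + b') * _]mulrDl !mulrDr !mulrDl !mulr1 !mul1r.
  rewrite !mulrA cbb cbb' !mul0r (_ : b * c * b' * c = 0); last first.
    by rewrite -2!mulrA (mulrA c) cbc mulr0.
  rewrite !addr0 cb -!addrA; congr (1 + _).
  rewrite 3!(addrCA _ (b' * c)) addKr.
  by congr (_ + _); rewrite addrA addrC [b' * c' + _]addrC.
- congr (_ * _); rewrite !mulrDl !mul1r mulrDr cbb cbb' addr0.
  by rewrite addrC addrA.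
- congr (_ * _); rewrite mulrDl mul1r [_ * (c + c')]mulrDr cbc add0r mulrDr mulr1 !mulrA.
  by rewrite addrAC.
- by rewrite mulrDr mulr1 addrC.
Qed.

End Coordinates.

(** * Homomorphisms of C^* with values of modulus 1 *)

Section UnitaryHomomorphism.
Local Open Scope complex_scope.
Variables (R : realType) (g : R[i] -> R[i]).
Hypothesis g_mul : forall z w, z != 0 -> w != 0 -> g (z * w) = g z * g w.
Hypothesis g_norm : forall z, z != 0 -> `|g z| = 1.

Lemma unitary_hom1 : g 1 = 1.
Proof.
have n1 : (1 : R[i]) != 0 := oner_neq0 _.
have g0 : g 1 != 0 by rewrite -normr_gt0 g_norm ?ltr01.
by apply: (mulfI g0); rewrite -g_mul // !mulr1.
Qed.

(* Along h = t l^* the modulus of 1 + h l grows linearly in t. *)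
Lemma unitary_hom_derivative (l : R[i]) :
  (forall e : R[i], 0 < e -> exists2 d : R[i], 0 < d &
     forall h, `|h| < d -> `|g (1 + h) - 1 - h * l| <= e * `|h|) ->
  l = 0.
Proof.
move=> dg; apply/eqP; apply: contraT => l0.
have nl : 0 < `|l| by rewrite normr_gt0.
have [|d d0 hd] := dg (`|l| / 2); first by rewrite divr_gt0 // ltr0n.
(* The halves make [t * l^*] smaller than both [d] and 1, so that the approximation applies and
   [1 + t * l^*] is nonzero. *)
pose t := Num.min (d / (2 * `|l|)) (1 / (2 * `|l|)).
have pos x : 0 < x -> 0 < x / (2 * `|l|).
  by move=> x0; rewrite divr_gt0 // mulr_gt0 // ltr0n.
have d10 : 0 < d / (2 * `|l|) := pos _ d0.
have t0 : 0 < t.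
  by rewrite /t /Num.min /Order.min; case: ifP => _; apply: pos.
have cmp : (d / (2 * `|l|) >=< 1 / (2 * `|l|))%O.
  by apply: real_comparable; apply: gtr0_real; apply: pos.
have two : (2 : R[i]) != 0 by rewrite pnatr_eq0.
have td : t * `|l| < d.
  apply: (@le_lt_trans _ _ (d / (2 * `|l|) * `|l|)).
    by rewrite ler_pM2r // comparable_ge_min // lexx.
  rewrite invfM mulrA mulfVK ?gt_eqF // ltr_pdivrMr ?ltr0n //.
  by rewrite ltr_pMr // ltr1n.
have t1 : t * `|l| < 1.
  apply: (@le_lt_trans _ _ (1 / (2 * `|l|) * `|l|)).
    by rewrite ler_pM2r // comparable_ge_min // lexx orbT.
  by rewrite invfM mulrA mulfVK ?gt_eqF // mul1r invf_lt1 ?ltr0n // ltr1n.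
have nh : `|t * l^*| = t * `|l| by rewrite normrM norm_conjC gtr0_norm.
have := hd (t * l^*); rewrite nh => /(_ td).
set G := g _.
have n1h : 1 + t * l^* != 0.
  apply/eqP => /eqP; rewrite addrC addr_eq0 => /eqP e.
  by move: nh t1; rewrite e normrN1 => <-; rewrite ltxx.
have hl : t * l^* * l = t * `|l| ^+ 2 by rewrite normCK -mulrA (mulrC l).
(* As [G] has modulus 1 and the error is at most half of [t * |l| ^+ 2], this is impossible. *)
have : `|1 + t * `|l| ^+ 2| <= `|G| + `|G - 1 - t * l^* * l|.
  rewrite hl -[X in `|X| <= _](_ : G - (G - 1 - t * `|l| ^+ 2) = _).
    exact: ler_normB.
  by rewrite -[G - 1 - _]addrA -opprD opprB addrCA subrr addr0.
rewrite g_norm // ger0_norm; last by rewrite addr_ge0 // mulr_ge0 ?exprn_ge0 ?(ltW t0).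
rewrite lerD2l => h1 h2; have := le_trans h1 h2.
have -> : `|l| / 2 * (t * `|l|) = t * `|l| ^+ 2 / 2.
  by rewrite expr2 mulrC !mulrA.
rewrite ler_pdivlMr ?ltr0n // ger_pMr ?lern1 //.
by rewrite mulr_gt0 // exprn_gt0.
Qed.

Hypothesis g_diff : forall e : R, 0 < e -> exists2 d : R, 0 < d &
  forall h : R[i], `|h| < d%:C -> `|g (1 + h) - 1| <= e%:C * `|h|.

(* Telescoping along the segment from 1 to z, which stays away from 0. *)
Lemma unitary_hom_pos (z : R[i]) : 0 < complex.Re z -> g z = 1.
Proof.
move=> z0; set x := z - 1.
pose m := Num.min 1 (complex.Re z).
have m0 : 0 < m by rewrite /m lt_min ltr01.
have m0C : 0 < m%:C by rewrite ltcR.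
have [X Xx] : exists X : R, `|x| = X%:C by exists (complex.Re `|x|); rewrite RRe_real.
have X0 : 0 <= X by rewrite -lecR -Xx normr_ge0.
apply/eqP; rewrite -subr_eq0 -normr_eq0; apply/eqP.
have [Y Yx] : exists Y : R, `|g z - 1| = Y%:C.
  by exists (complex.Re `|g z - 1|); rewrite RRe_real.
rewrite Yx; congr (_%:C); apply/eqP; rewrite eq_le; apply/andP; split; last first.
  by rewrite -lecR -Yx normr_ge0.
apply/ler_addgt0Pl => e e0; rewrite addr0.
(* Each of the [n] steps has a relative increment of modulus at most [X / (n m)], so this tolerance
   adds up to [e * X / (X + 1)], which is at most [e]. The summand 1 covers [X = 0]. *)
have e'0 : 0 < e * m / (X + 1) by rewrite divr_gt0 ?mulr_gt0 // ltr_wpDl.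
have [d d0 hd] := g_diff e'0.
pose n := (Num.truncn (X / (m * d))).+1.
have n0 : (0 : R) < n%:R by rewrite ltr0n.
have nd : X / n%:R / m < d.
  rewrite ltr_pdivrMr // ltr_pdivrMr // [_ * n%:R]mulrC -ltr_pdivrMr ?mulr_gt0 //.
  by rewrite (mulrC d) /n truncnS_gt.
pose p (j : nat) : R[i] := 1 + (j%:R / n%:R : R)%:C * x.
have pm j : (j <= n)%N -> m%:C <= `|p j|.
  move=> jn; apply: le_trans (normc_ge_Re (p j)); rewrite lecR.
  apply: le_trans (ler_norm _).
  have -> : complex.Re (p j) = 1 + (j%:R / n%:R) * (complex.Re z - 1).
    by rewrite /p /x; case: (z) => u v /=; rewrite mul0r subr0.
  set s := j%:R / n%:R.
  have s0 : 0 <= s by rewrite divr_ge0 ?ler0n.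
  have s1 : s <= 1 by rewrite ler_pdivrMr // mul1r ler_nat.
  have -> : 1 + s * (complex.Re z - 1) = (1 - s) * 1 + s * complex.Re z.
    by rewrite mulr1 mulrBr mulr1 addrA addrAC.
  have -> : m = (1 - s) * m + s * m by rewrite -mulrDl subrK mul1r.
  apply: lerD; apply: ler_wpM2l; rewrite ?subr_ge0 //.
    by rewrite /m ge_min lexx.
  by rewrite /m ge_min lexx orbT.
have p0 j : (j <= n)%N -> p j != 0.
  by move=> /pm h; rewrite -normr_gt0; apply: lt_le_trans h.
have step j : (j < n)%N -> `|g (p j.+1) - g (p j)| <= (e / n%:R)%:C.
  (* Passing from [p j] to [p j.+1] is multiplication by [1 + h]. Since [g (p j)] has modulus 1, the
     estimate at 1 holds unchanged at [p j]. *)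
  move=> jn; pose h := (n%:R^-1 : R)%:C * x / p j.
  have pj : p j != 0 by rewrite p0 // ltnW.
  have pS : p j.+1 = p j * (1 + h).
    have e1 : p j * h = (n%:R^-1)%:C * x by rewrite /h mulrC divfK.
    rewrite mulrDr mulr1 e1 /p -addrA -mulrDl -rmorphD /= -natr1.
    by rewrite [(_ + _) / _]mulrDl mul1r.
  have h1 : 1 + h != 0.
    by apply: contra_neq (p0 _ jn) => e1; rewrite pS e1 mulr0.
  have nh : `|h| <= (X / n%:R / m)%:C.
    rewrite /h normrM normfV normrM Xx normc_def /= expr0n addr0 sqrtr_sqr.
    rewrite ger0_norm ?invr_ge0 ?ler0n // -rmorphM /=.
    rewrite [X in _ <= X]rmorphM fmorphV /= [n%:R^-1 * _]mulrC.
    apply: ler_wpM2l; first by rewrite lecR divr_ge0 ?ler0n.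
    by rewrite lef_pV2 ?posrE ?normr_gt0 // pm // ltnW.
  rewrite pS g_mul // -{2}[g (p j)]mulr1 -mulrBr normrM g_norm // mul1r.
  apply: le_trans (hd _ _) _; first by apply: le_lt_trans nh _; rewrite ltcR.
  apply: (@le_trans _ _ ((e * m / (X + 1))%:C * (X / n%:R / m)%:C)).
    by apply: ler_wpM2l => //; rewrite lecR ltW.
  rewrite -rmorphM /= lecR.
  have -> : e * m / (X + 1) * (X / n%:R / m) = e / n%:R * (X / (X + 1)).
    have X10 : X + 1 != 0 by rewrite gt_eqF // ltr_wpDl.
    by field; rewrite X10 !gt_eqF.
  rewrite ger_pMr ?divr_gt0 // ler_pdivrMr ?ltr_wpDl // mul1r lerDl //.
have tele k : (k <= n)%N -> `|g (p k) - 1| <= (e / n%:R * k%:R)%:C.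
  elim: k => [|k IH] kn.
    by rewrite /p mul0r mul0r addr0 unitary_hom1 subrr normr0 mulr0.
  have -> : g (p k.+1) - 1 = (g (p k.+1) - g (p k)) + (g (p k) - 1).
    by rewrite addrA subrK.
  apply: le_trans (ler_normD _ _) _.
  rewrite -natr1 mulrDr mulr1 addrC rmorphD /=.
  by apply: lerD; [apply: IH; apply: ltnW | apply: step].
have := tele n (leqnn n); rewrite /p divff ?gt_eqF // mul1r [1 + x]addrC subrK.
by rewrite Yx divfK ?gt_eqF // lecR.
Qed.

(** The right half-plane generates [C^*]: [i = (1 + i)^2 / 2] gives the value at [i], its square the
    value at [-1]. Multiplication by [-1] reaches the left half-plane, and multiplication by [i]
    moves the imaginary axis off itself. *)
Lemma unitary_hom_trivial (z : R[i]) : z != 0 -> g z = 1.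
Proof.
have pos := unitary_hom_pos.
have i0 : 'i%C != 0 :> R[i] by rewrite eq_complex /= oner_eq0 andbF.
have gi : g 'i%C = 1.
  have e : 'i%C = (1 + 'i%C) * (1 + 'i%C) * (2^-1 : R)%:C :> R[i].
    rewrite -expr2 sqrrD expr1n sqr_i mul1r addrAC subrr add0r.
    by rewrite fmorphV rmorph_nat -mulr_natr mulfK ?pnatr_eq0.
  have n1 : 1 + 'i%C != 0 :> R[i] by rewrite eq_complex /= addr0 oner_eq0.
  have n2 : (2^-1 : R)%:C != 0 by rewrite eq_complex /= invr_eq0 pnatr_eq0.
  rewrite e !g_mul ?mulf_neq0 // !pos ?mulr1 //=; rewrite ?addr0 ?invr_gt0 ?ltr0n //.
have gN1 : g (-1) = 1 by rewrite -sqr_i expr2 g_mul // gi mulr1.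
have N10 : -1 != 0 :> R[i] by rewrite oppr_eq0 oner_eq0.
have right (w : R[i]) : w != 0 -> complex.Re w != 0 -> g w = 1.
  move=> w0; rewrite neq_lt => /orP[wn|]; last exact: pos.
  rewrite -[w]opprK -mulN1r g_mul ?oppr_eq0 // gN1 mul1r pos //.
  by move: wn; case: (w) => u v /=; rewrite oppr_gt0.
move=> z0; have [rz|] := eqVneq (complex.Re z) 0; last exact: right.
rewrite -[g z]mul1r -{1}gi -g_mul //; apply: right; first by rewrite mulf_neq0.
move: z0 rz; case: (z) => u v /=; rewrite eq_complex /= => h u0.
by move: h; rewrite u0 eqxx /= !mul0r mul1r sub0r oppr_eq0.
Qed.

End UnitaryHomomorphism.

(** * Derivatives on the punctured plane *)

Section PuncturedPlane.
Variable K : numFieldType.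
Implicit Types (f : K -> K^o) (z : K).

(** The predicate [holomorphic] is the case [K = R[i]]. *)
Definition smooth0 f := forall n z, z != 0 -> derivable (derive1n n f) z 1.

Lemma near_neq0 z : z != 0 -> \forall w \near z, w != 0.
Proof.
move=> z0; apply/nbhs_ballP; exists `|z|; first by rewrite /= normr_gt0.
move=> w /=; rewrite -ball_normE /= => h; apply: contraTneq h => ->.
by rewrite subr0 ltxx.
Qed.

(** The punctured plane is open, so agreement on it is agreement near each of its points and passes
    to derivatives. *)
Lemma derive1n_eq f f' : (forall z, z != 0 -> f z = f' z) ->
  forall n z, z != 0 -> derive1n n f z = derive1n n f' z.
Proof.
move=> ff'; elim=> [|n IH] z z0; first exact: ff'.
rewrite !derive1nS !derive1E; apply: near_eq_derive.
by near=> w; apply: IH; near: w; exact: near_neq0.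
Unshelve. all: by end_near. Qed.

Lemma is_derive_expV (k : K) m z : z != 0 ->
  is_derive z 1 (fun w : K => k * w ^- m) (- (k * m%:R) * z ^- m.+1).
Proof.
move=> z0.
have dX : is_derive z 1 (fun w : K => w ^+ m) (m%:R * z ^+ m.-1).
  have := is_deriveX m (is_derive_id z (1 : K)).
  rewrite exprfctE => h.
  by apply: (is_derive_eq h); rewrite /GRing.scale /= mulr1.
have zm : z ^+ m != 0 by rewrite expf_neq0.
case: dX => dX eX.
have dV := derivableV (f := fun w : K => w ^+ m) zm dX.
have eV := deriveV (f := fun w : K => w ^+ m) zm dX.
apply: DeriveDef.
  exact: (derivableM (derivable_cst k z 1) dV).
have := deriveMl (f := fun w : K => (w ^+ m)^-1) k dV.
rewrite eV eX => h.
transitivity (k * (- (z ^+ m) ^- 2 *: (m%:R * z ^+ m.-1))); first exact: h.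
rewrite /GRing.scale /= !mulNr mulrN; congr (- _); rewrite -mulrA; congr (_ * _).
(* For [m = 0] the exponent [m.-1] is truncated, but its factor [m%:R] vanishes. *)
rewrite mulrCA; case: m {dX eX dV eV zm h} => [|m]; first by rewrite !mul0r.
congr (_ * _) => /=; apply: (mulIf (expf_neq0 m.+2 z0)); rewrite mulVf ?expf_neq0 //.
rewrite -mulrA -exprD (_ : m + m.+2 = m.+1 * 2)%N; last first.
  by rewrite muln2 doubleS !addnS addnn.
by rewrite exprM mulVf // !expf_neq0.
Qed.

(** The product [(m + 1) ... (m + n)] is written as a falling factorial, which division by [n!]
    turns into a binomial coefficient in the Taylor sum. *)
Lemma derive1n_expV (k : K) m n z : z != 0 ->
  derive1n n (fun w : K => k * w ^- m.+1) z =
  k * (-1) ^+ n * ((m + n) ^_ n)%:R * z ^- (m.+1 + n).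
Proof.
elim: n z => [|n IH] z z0; first by rewrite derive1n0 expr0 !addn0 ffactn0 !mulr1.
rewrite derive1nS derive1E.
pose k' := k * (-1) ^+ n * ((m + n) ^_ n)%:R.
transitivity ('D_1 (fun w : K => k' * w ^- (m.+1 + n)) z).
  apply: near_eq_derive; near=> w; rewrite IH //; near: w; exact: near_neq0.
have h := is_derive_expV k' (m.+1 + n) z0; rewrite derive_val /k'.
rewrite addnS ffactnS; rewrite addnS exprS addSn /= natrM (exprS (-1)).
congr (_ / _); rewrite mulN1r !mulrN mulNr -!mulrA [_%:R * _%:R]mulrC //.
Unshelve. all: by end_near. Qed.

Lemma smooth0_expV (k : K) m : smooth0 (fun w : K => k * w ^- m.+1).
Proof.
move=> n z z0.
pose k' := k * (-1) ^+ n * ((m + n) ^_ n)%:R.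
apply: (@near_eq_derivable _ _ _ (fun w : K => k' * w ^- (m.+1 + n))).
  by near=> w; rewrite derive1n_expV; [done|]; near: w; exact: near_neq0.
by have [] := is_derive_expV k' (m.+1 + n) z0.
Unshelve. all: by end_near. Qed.

Lemma derive1n_cst (k : K) n z :
  derive1n n (fun=> k : K^o) z = if n is 0%N then k else 0.
Proof.
case: n => [|n] //; elim: n z => [|n IH] z.
  by rewrite derive1n1 derive1E derive_cst.
rewrite derive1nS derive1E (_ : derive1n _ _ = cst (0 : K^o)); last exact/funext.
by rewrite derive_cst.
Qed.

Lemma smooth0_cst (k : K) : smooth0 (fun=> k : K^o).
Proof.
case=> [|n] z _; first exact: derivable_cst.
rewrite (_ : derive1n _ _ = cst (0 : K^o)); last first.
  by apply/funext => w; rewrite derive1n_cst.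
exact: derivable_cst.
Qed.

Lemma derive1n_id n z : derive1n n (@id K : K -> K^o) z =
  if n is n'.+1 then (n' == 0%N)%:R else z.
Proof.
case: n => [|n] //; elim: n z => [|n IH] z; first by rewrite derive1n1 derive1E derive_id.
rewrite derive1nS derive1E (_ : derive1n _ _ = cst ((n == 0%N)%:R : K^o));
  last exact/funext.
by rewrite derive_cst.
Qed.

Lemma smooth0_id : smooth0 (@id K : K -> K^o).
Proof.
case=> [|n] z _; first exact: derivable_id.
rewrite (_ : derive1n _ _ = cst ((n == 0%N)%:R : K^o)); last first.
  by apply/funext => w; rewrite derive1n_id.
exact: derivable_cst.
Qed.

Lemma derivable_linear_approx f : derivable f 1 1 -> exists l : K,
  forall e : K, 0 < e -> exists2 d : K, 0 < d &
    forall h, `|h| < d -> `|f (1 + h) - f 1 - h * l| <= e * `|h|.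
Proof.
move=> /cvg_ex[l hl]; exists l => e e0.
move/cvgrPdist_le: hl => /(_ e e0)/nbhs_ballP[d d0 hd].
exists d => // h hd'; have [->|h0] := eqVneq h 0.
  by rewrite addr0 subrr mul0r subr0 !normr0 mulr0.
have := hd h; rewrite -ball_normE /= sub0r normrN => /(_ hd' h0).
rewrite /= /GRing.scale /= mulr1 => hh.
have -> : f (1 + h) - f 1 - h * l = h * - (l - h^-1 * (f (h + 1) - f 1)).
  by rewrite opprB mulrBr mulVKf // (addrC h).
by rewrite normrM normrN mulrC ler_wpM2r.
Qed.

Lemma derivable_idM f z :
  derivable f z 1 -> derivable (fun w : K => w * f w : K^o) z 1.
Proof. exact: (derivableM (@derivable_id _ _ z 1)). Qed.

End PuncturedPlane.

Section Holomorphic.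
Local Open Scope complex_scope.
Variable R : realType.
Local Notation C := (R[i]^o).
(** The function [z * chi z] is a homomorphism of modulus 1. Once its derivative at 1 is known to
    vanish, the linear approximation at 1 becomes the small-increment bound that telescoping
    requires. *)
Lemma holomorphic_hom_inv (chi : C -> C) : holomorphic chi ->
  (forall z w, z != 0 -> w != 0 -> chi (z * w) = chi z * chi w) ->
  (forall z, z != 0 -> `|z * chi z| = 1) ->
  forall z, z != 0 -> chi z = z^-1.
Proof.
move=> hol chiM chi_norm z z0; pose g (w : R[i]) : R[i] := w * chi w.
have gM w w' : w != 0 -> w' != 0 -> g (w * w') = g w * g w'.
  by move=> w0 w'0; rewrite /g chiM // mulrACA.
have g1 := unitary_hom1 gM chi_norm.
have dg : derivable (g : C -> C) 1 1.
  exact: derivable_idM (hol 0%N 1 (oner_neq0 _)).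
have [l hl] := derivable_linear_approx dg.
rewrite g1 in hl; have l0 := unitary_hom_derivative chi_norm hl.
suff : g z = 1 by move=> gz; apply: (mulfI z0); rewrite mulfV.
apply: (unitary_hom_trivial gM chi_norm) => // e e0.
have [|d d0 hd] := hl e%:C; first by rewrite ltcR.
exists (complex.Re d); first by move: d0; rewrite ltcE /= => /andP[].
move=> h; rewrite RRe_real ?gtr0_real // => /hd.
by rewrite l0 mulr0 subr0.
Qed.

End Holomorphic.

(** * Negative binomial series and Taylor evaluation at superpoints *)

Section NegativeBinomial.
Variable A : pzRingType.
Implicit Types (u : A) (m n : nat).

(** Pascal's rule: multiplication by [1 - u] lowers [m] by one, up to a boundary term in
    [u ^+ n]. *)
Lemma negbin_recr u m n :
  (1 - u) * (\sum_(i < n) u ^+ i *+ 'C(m.+1 + i, m.+1)) =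
  \sum_(i < n) u ^+ i *+ 'C(m + i, m) - u ^+ n *+ 'C(m + n, m.+1).
Proof.
elim: n => [|n IH].
  by rewrite !big_ord0 mulr0 addn0 bin_small // mulr0n subr0.
rewrite !big_ord_recr /= mulrDr IH -addrA -addrA; congr (_ + _).
rewrite mulrBl mul1r mulrnAr -exprS addrA addSn addnS; congr (_ - _).
by rewrite binS mulrnDr addKr.
Qed.

Lemma negbin u m n : u ^+ n = 0 ->
  (1 - u) ^+ m.+1 * (\sum_(i < n) u ^+ i *+ 'C(m + i, m)) = 1.
Proof.
move=> un0; elim: m => [|m IH]; last first.
  by rewrite exprSr -mulrA negbin_recr un0 mul0rn subr0.
rewrite expr1 (eq_bigr (fun i : 'I_n => u ^+ i)) => [|i _]; last by rewrite bin0.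
by have := subrX1 u n; rewrite un0 sub0r -(opprB 1 u) mulNr => /oppr_inj <-.
Qed.

End NegativeBinomial.

Section Taylor.
Variables (R : realType) (A : superpoint R).
Local Notation C := (R[i]^o).
Implicit Types (f : C -> C) (x : A).

Lemma body_neq0 x : x \is a GRing.unit -> (body A x : R[i]) != 0.
Proof.
by move=> ux; have := rmorph_unit (body A) ux; rewrite unitfE.
Qed.

Lemma body_scalar (k : R[i]) : body A k%:A = k.
Proof. by rewrite linearZ rmorph1 /= /GRing.scale /= mulr1. Qed.

(** Order 0 would give [1 = 0 ^+ 0 = 0]. Hence the sum in [taylor] always has its constant term. *)
Lemma nil_orderS : nil_order A = (nil_order A).-1.+1.
Proof.
case e : (nil_order A) => [|n] //; have := @body_nil _ A 0 (raddf0 _).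
by rewrite e expr0 => /eqP; rewrite oner_eq0.
Qed.

Lemma nilpotent_part x : (x - (body A x : R[i])%:A) ^+ nil_order A = 0.
Proof. by apply: body_nil; rewrite raddfB /= body_scalar subrr. Qed.

(** Only derivatives at the body enter, and the body of a unit is nonzero. This carries identities
    from the ordinary point to all superpoints. *)
Lemma taylor_eq f f' x : x \is a GRing.unit ->
  (forall z, z != 0 -> f z = f' z) -> taylor f x = taylor f' x.
Proof.
move=> ux ff'; apply: eq_bigr => k _.
by rewrite (derive1n_eq ff' k (body_neq0 ux)).
Qed.

Lemma taylor_scalar f (k : R[i]) : taylor f (k%:A : A) = (f k : R[i])%:A.
Proof.
rewrite /taylor body_scalar subrr nil_orderS big_ord_recl big1 => [|i _].
  by rewrite addr0 expr0 fact0 divr1.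
by rewrite expr0n scaler0.
Qed.

Lemma taylor1 f : taylor f (1 : A) = (f 1 : R[i])%:A.
Proof. by rewrite -[X in taylor f X]scale1r taylor_scalar. Qed.

Lemma taylor_cst (k : R[i]) x :
  taylor (fun=> k : R[i]^o) x = k%:A.
Proof.
have dE n z : derive1n n (fun=> k : R[i]^o) z = if n is 0%N then k else 0.
  exact: (@derive1n_cst R[i]).
rewrite /taylor nil_orderS big_ord_recl big1 => [|i _].
  by rewrite dE /= expr0 divr1 addr0.
by rewrite dE /= mul0r scale0r.
Qed.

Lemma taylor_id x : taylor id x = x.
Proof.
have dE n z : derive1n n (@id C) z = if n is n'.+1 then (n' == 0%N)%:R else z.
  exact: (@derive1n_id R[i]).
have := nilpotent_part x; rewrite /taylor nil_orderS big_ord_recl.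
set e := x - _; rewrite expr0 fact0 divr1.
(* For nilpotency order 1 the Taylor sum has no linear term, but then the nilpotent part [e] is
   itself zero. *)
case: (nil_order A).-1 => [|n] en0.
  by rewrite big_ord0 addr0; apply/esym/eqP; rewrite -subr_eq0 -/e -[e]expr1 en0.
rewrite big_ord_recl big1 => [|i _].
  by rewrite !dE /= expr1 divr1 scale1r addr0 addrC subrK.
by rewrite dE /= mul0r scale0r.
Qed.

(** Write [x = b (1 - u)] with [b] the body and [u] nilpotent. The Taylor sum becomes [b ^- m.+1]
    times the truncated negative binomial series, which is an exact inverse of [(1 - u) ^+ m.+1]. *)
Lemma taylor_expV (k : R[i]) m x : x \is a GRing.unit ->
  taylor (fun z : C => k * z ^- m.+1) x = k *: x ^- m.+1.
Proof.
move=> ux; have b0 := body_neq0 ux; have := nilpotent_part x.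
set b := (body A x : R[i]) in b0 *; set n := nil_order A; set e := x - _ => en0.
pose u := - b^-1 *: e.
have un0 : u ^+ n = 0 by rewrite exprZn en0 scaler0.
have xu : x = b *: (1 - u).
  by rewrite /u scaleNr opprK scalerDr scalerA mulfV // scale1r /e addrC subrK.
have -> : taylor (fun z : C => k * z ^- m.+1) x =
          k *: (b ^- m.+1 *: \sum_(i < n) u ^+ i *+ 'C(m + i, m)).
  rewrite /taylor -/b -/e !scaler_sumr; apply: eq_bigr => i _.
  rewrite (@derive1n_expV R[i] k m i _ b0) -[in RHS]scaler_nat !scalerA /u exprZn scalerA.
  congr (_ *: _); rewrite -bin_ffact natrM.
  have -> : 'C(m + i, i) = 'C(m + i, m) by rewrite -(bin_sub (leq_addr i m)) addKn.
  have f0 : (i`!%:R : R[i]) != 0 by rewrite pnatr_eq0 -lt0n fact_gt0.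
  rewrite [(- b^-1) ^+ i]exprNn exprVn exprD invfM.
  by field; rewrite f0 !expf_neq0.
congr (_ *: _).
have um : x ^+ m.+1 \is a GRing.unit by rewrite unitrX.
apply: (mulrI um); rewrite divrr // {1}xu exprZn -scalerAl -scalerAr negbin //.
by rewrite scalerA mulfV ?expf_neq0 // scale1r.
Qed.

End Taylor.

(* Coordinates with respect to 1, t, s, ts. *)
Definition grassmann2 (R : realType) : Type :=
  (R[i]^o * R[i]^o * R[i]^o * R[i]^o)%type.

(** * The Grassmann algebra on two generators as a real superpoint *)

Section Grassmann.
Local Open Scope complex_scope.
Variable R : realType.
Local Notation G := (grassmann2 R).
HB.instance Definition _ := GRing.Lmodule.on G.

Definition gr (x0 x1 x2 x3 : R[i]) : G := (x0, x1, x2, x3).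
Definition gr_one : G := gr 1 0 0 0.
Definition gr_mul (x y : G) : G :=
  let: (x0, x1, x2, x3) := x in let: (y0, y1, y2, y3) := y in
  gr (x0 * y0) (x0 * y1 + x1 * y0) (x0 * y2 + x2 * y0)
     (x0 * y3 + x3 * y0 + (x1 * y2 - x2 * y1)).
Definition gr_unit : pred G := fun x => x.1.1.1 != 0.
(** The nilpotent part squares to zero, so the geometric series stops after its linear term.
    Non-units are returned unchanged, as the unit ring structure demands. *)
Definition gr_inv (x : G) : G :=
  let: (x0, x1, x2, x3) := x in
  if x0 == 0 then x else
  gr x0^-1 (- x1 * x0 ^- 2) (- x2 * x0 ^- 2) (- x3 * x0 ^- 2).

Lemma gr_add x0 x1 x2 x3 y0 y1 y2 y3 :
  gr x0 x1 x2 x3 + gr y0 y1 y2 y3 = gr (x0 + y0) (x1 + y1) (x2 + y2) (x3 + y3).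
Proof. by []. Qed.

Lemma gr_scale (k x0 x1 x2 x3 : R[i]) :
  k *: gr x0 x1 x2 x3 =
  gr (k * x0) (k * x1) (k * x2) (k * x3).
Proof. by []. Qed.

Fact gr_mulA : associative gr_mul.
Proof.
move=> [[[x0 x1] x2] x3] [[[y0 y1] y2] y3] [[[z0 z1] z2] z3].
by rewrite /gr_mul /=; congr gr; ring.
Qed.

Fact gr_mul1 : left_id gr_one gr_mul.
Proof. by move=> [[[x0 x1] x2] x3]; rewrite /gr_mul /=; congr (_, _, _, _); ring. Qed.

Fact gr_mulr1 : right_id gr_one gr_mul.
Proof. by move=> [[[x0 x1] x2] x3]; rewrite /gr_mul /=; congr (_, _, _, _); ring. Qed.

Fact gr_mulDl : left_distributive gr_mul +%R.
Proof.
move=> [[[x0 x1] x2] x3] [[[y0 y1] y2] y3] [[[z0 z1] z2] z3].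
by rewrite gr_add /gr_mul /= gr_add; congr gr; ring.
Qed.

Fact gr_mulDr : right_distributive gr_mul +%R.
Proof.
move=> [[[x0 x1] x2] x3] [[[y0 y1] y2] y3] [[[z0 z1] z2] z3].
by rewrite gr_add /gr_mul /= gr_add; congr gr; ring.
Qed.

Fact gr_one_neq0 : gr_one != 0.
Proof. by apply/eqP => -[/eqP]; rewrite oner_eq0. Qed.

HB.instance Definition _ := GRing.Zmodule_isNzRing.Build G
  gr_mulA gr_mul1 gr_mulr1 gr_mulDl gr_mulDr gr_one_neq0.

Lemma gr_mulE x0 x1 x2 x3 y0 y1 y2 y3 :
  gr x0 x1 x2 x3 * gr y0 y1 y2 y3 = gr (x0 * y0) (x0 * y1 + x1 * y0)
    (x0 * y2 + x2 * y0) (x0 * y3 + x3 * y0 + (x1 * y2 - x2 * y1)).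
Proof. by []. Qed.

Lemma gr_ext (x : G) : exists x0 x1 x2 x3, x = gr x0 x1 x2 x3.
Proof. by case: x => [[[x0 x1] x2] x3]; exists x0, x1, x2, x3. Qed.

Fact gr_scaleAl (k : R[i]) (x y : G) : k *: (x * y) = (k *: x : G) * y.
Proof.
have [x0 [x1 [x2 [x3 ->]]]] := gr_ext x; have [y0 [y1 [y2 [y3 ->]]]] := gr_ext y.
by rewrite !(gr_scale, gr_mulE); congr gr; ring.
Qed.

HB.instance Definition _ := GRing.Lmodule_isLalgebra.Build R[i] G gr_scaleAl.

Fact gr_scaleAr (k : R[i]) (x y : G) : k *: (x * y) = x * (k *: y : G).
Proof.
have [x0 [x1 [x2 [x3 ->]]]] := gr_ext x; have [y0 [y1 [y2 [y3 ->]]]] := gr_ext y.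
by rewrite !(gr_scale, gr_mulE); congr gr; ring.
Qed.

HB.instance Definition _ := GRing.Lalgebra_isAlgebra.Build R[i] G gr_scaleAr.

Fact gr_mulVr : {in gr_unit, left_inverse 1 gr_inv *%R}.
Proof.
move=> x; have [x0 [x1 [x2 [x3 ->]]]] := gr_ext x; rewrite unfold_in /= => x0n.
by rewrite /gr_inv /= (negbTE x0n) gr_mulE; congr gr; field.
Qed.

Fact gr_mulrV : {in gr_unit, right_inverse 1 gr_inv *%R}.
Proof.
move=> x; have [x0 [x1 [x2 [x3 ->]]]] := gr_ext x; rewrite unfold_in /= => x0n.
by rewrite /gr_inv /= (negbTE x0n) gr_mulE; congr gr; field.
Qed.

Fact gr_unitP (x y : G) : y * x = 1 /\ x * y = 1 -> gr_unit x.
Proof.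
case: x y => [[[x0 x1] x2] x3] [[[y0 y1] y2] y3] [] [] e _ _ _ _.
apply/eqP => /= x00; move/eqP: e; rewrite x00 mulr0 eq_sym.
by rewrite oner_eq0.
Qed.

Fact gr_inv_out : {in [predC gr_unit], gr_inv =1 id}.
Proof.
by move=> [[[x0 x1] x2] x3]; rewrite !inE unfold_in /= negbK => x00; rewrite /gr_inv x00.
Qed.

HB.instance Definition _ := GRing.NzRing_hasMulInverse.Build G
  gr_mulVr gr_mulrV gr_unitP gr_inv_out.

Definition gr_par (e : bool) : {pred G} := fun x =>
  let: (x0, x1, x2, x3) := x in
  if e then (x0 == 0) && (x3 == 0) else (x1 == 0) && (x2 == 0).

Fact gr_par_submod e : submod_closed (gr_par e).
Proof.
split; first by rewrite unfold_in; case: e; rewrite /= eqxx.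
move=> k [[[x0 x1] x2] x3] [[[y0 y1] y2] y3]; rewrite !unfold_in.
by case: e => /= /andP[/eqP-> /eqP->] /andP[/eqP-> /eqP->];
  rewrite !scaler0 !addr0 eqxx.
Qed.

Fact gr_par_decomp (x : G) : exists x0 x1,
  [/\ x0 \in gr_par false, x1 \in gr_par true & x = x0 + x1].
Proof.
case: x => [[[x0 x1] x2] x3]; exists (gr x0 0 0 x3), (gr 0 x1 x2 0).
rewrite !unfold_in /= !eqxx gr_add; split=> //.
by rewrite !addr0 !add0r.
Qed.

Fact gr_par_direct (x : G) : x \in gr_par false -> x \in gr_par true -> x = 0.
Proof.
case: x => [[[x0 x1] x2] x3]; rewrite !unfold_in /=.
by move=> /andP[/eqP-> /eqP->] /andP[/eqP-> /eqP->].
Qed.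

Fact gr_par_one : 1 \in gr_par false.
Proof. by rewrite unfold_in /= eqxx. Qed.

Fact gr_par_mul e e' (x y : G) :
  x \in gr_par e -> y \in gr_par e' -> x * y \in gr_par (e (+) e').
Proof.
case: x y => [[[x0 x1] x2] x3] [[[y0 y1] y2] y3]; rewrite !unfold_in.
by case: e e' => [] [] /= /andP[/eqP ? /eqP ?] /andP[/eqP ? /eqP ?]; subst;
  rewrite ?(mul0r, mulr0, add0r, addr0, subr0) ?eqxx ?oppr0 ?eqxx.
Qed.

Lemma gr_evenP x : x \in gr_par false -> exists x0 x3, x = gr x0 0 0 x3.
Proof.
case: x => [[[x0 x1] x2] x3]; rewrite unfold_in => /andP[/eqP-> /eqP->].
by exists x0, x3.
Qed.

Lemma gr_oddP x : x \in gr_par true -> exists x1 x2, x = gr 0 x1 x2 0.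
Proof.
case: x => [[[x0 x1] x2] x3]; rewrite unfold_in => /andP[/eqP-> /eqP->].
by exists x1, x2.
Qed.

Lemma gr_opp x0 x1 x2 x3 : - gr x0 x1 x2 x3 = gr (- x0) (- x1) (- x2) (- x3).
Proof. by []. Qed.

Fact gr_par_comm e e' (x y : G) : x \in gr_par e -> y \in gr_par e' ->
  x * y = (-1) ^+ (e && e') * (y * x).
Proof.
case: e e' => [] [].
- move=> /gr_oddP[x1 [x2 ->]] /gr_oddP[y1 [y2 ->]].
  by rewrite expr1 mulN1r !gr_mulE gr_opp; congr gr; ring.
- move=> /gr_oddP[x1 [x2 ->]] /gr_evenP[y0 [y3 ->]].
  by rewrite expr0 mul1r !gr_mulE; congr gr; ring.
- move=> /gr_evenP[x0 [x3 ->]] /gr_oddP[y1 [y2 ->]].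
  by rewrite expr0 mul1r !gr_mulE; congr gr; ring.
- move=> /gr_evenP[x0 [x3 ->]] /gr_evenP[y0 [y3 ->]].
  by rewrite expr0 mul1r !gr_mulE; congr gr; ring.
Qed.

Definition gr_superalgebra : superalgebra R[i] :=
  Superalgebra gr_par_submod gr_par_decomp gr_par_direct gr_par_one
    gr_par_mul gr_par_comm.

Definition gr_body_fun (x : gr_superalgebra) : R[i]^o := (x : G).1.1.1.

Fact gr_body_linear : linear gr_body_fun.
Proof. by move=> k [[[x0 x1] x2] x3] [[[y0 y1] y2] y3]. Qed.

Fact gr_body_monoid : monoid_morphism gr_body_fun.
Proof. by split=> // -[[[x0 x1] x2] x3] [[[y0 y1] y2] y3]. Qed.

HB.instance Definition _ :=
  GRing.isLinear.Build R[i] gr_superalgebra R[i]^o *:%R gr_body_fun gr_body_linear.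
HB.instance Definition _ :=
  GRing.isMonoidMorphism.Build gr_superalgebra R[i]^o gr_body_fun gr_body_monoid.

Definition gr_body : {lrmorphism gr_superalgebra -> R[i]^o} := gr_body_fun.

Fact gr_body_nil (x : gr_superalgebra) : gr_body x = 0 -> x ^+ 2 = 0.
Proof.
have [x0 [x1 [x2 [x3 ->]]]] := gr_ext x => /= h; rewrite expr2 gr_mulE.
by rewrite /gr_body_fun /= in h; rewrite h; congr gr; ring.
Qed.

Definition gr_superpoint : superpoint R := Superpoint gr_body_nil.

Definition gr_bar_fun (x : gr_superpoint) : gr_superpoint :=
  let: (x0, x1, x2, x3) := (x : G) in gr x0^*%C x1^*%C x2^*%C x3^*%C.

Fact gr_bar_additive : zmod_morphism gr_bar_fun.
Proof.
move=> [[[x0 x1] x2] x3] [[[y0 y1] y2] y3].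
by have cB := rmorphB (@conjc R); congr gr; rewrite [LHS]cB.
Qed.

Fact gr_bar_monoid : monoid_morphism gr_bar_fun.
Proof.
split; first by congr gr; rewrite ?conjc1 ?conjc0.
have cM := rmorphM (@conjc R); have cD := rmorphD (@conjc R).
have cB := rmorphB (@conjc R).
move=> [[[x0 x1] x2] x3] [[[y0 y1] y2] y3]; congr gr.
- exact: cM.
- by rewrite [LHS]cD !cM.
- by rewrite [LHS]cD !cM.
- by rewrite [LHS]cD cB cD !cM.
Qed.

HB.instance Definition _ :=
  GRing.isZmodMorphism.Build gr_superpoint gr_superpoint gr_bar_fun gr_bar_additive.
HB.instance Definition _ :=
  GRing.isMonoidMorphism.Build gr_superpoint gr_superpoint gr_bar_fun gr_bar_monoid.

Definition gr_bar : {rmorphism gr_superpoint -> gr_superpoint} := gr_bar_fun.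

Fact gr_bar_scale (k : R[i]) (x : gr_superpoint) :
  gr_bar (k *: x) = k^*%C *: gr_bar x.
Proof.
case: x => [[[x0 x1] x2] x3].
by have cM := rmorphM (@conjc R); congr gr; rewrite [LHS]cM.
Qed.

Fact gr_bar_invol (x : gr_superpoint) : gr_bar (gr_bar x) = x.
Proof. by case: x => [[[x0 x1] x2] x3]; congr gr; exact: conjcK. Qed.

Fact gr_bar_par e (x : gr_superpoint) : x \in par e -> gr_bar x \in par e.
Proof.
case: x => [[[x0 x1] x2] x3]; rewrite !unfold_in.
by case: e => /andP[/eqP-> /eqP->]; apply/andP; split; apply/eqP; exact: conjc0.
Qed.

Definition gr_point : real_superpoint R :=
  RealSuperpoint gr_bar_scale gr_bar_invol gr_bar_par.

(** The two generators serve; they make the commutator of [exp (b E)] and [exp (c F)] visible. *)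
Lemma odd_product_neq0 : exists (A : real_superpoint R) (b c : A),
  [/\ b \in par true, c \in par true & b * c != 0].
Proof.
exists gr_point, (gr 0 1 0 0), (gr 0 0 1 0).
split; [by apply/andP; split; apply/eqP|by apply/andP; split; apply/eqP|].
apply/eqP => e.
have /eqP : 0 * 0 + 0 * 0 + (1 * 1 - 0 * 0) = 0 :> R[i] := congr1 (fun x : G => x.2) e.
by rewrite !mul0r mulr1 !add0r subr0 oner_eq0.
Qed.

End Grassmann.

(** * Explicit automorphisms of SL(1|1) *)

Section Slmx.
Variables (K : numFieldType) (A : superalgebra K).
Implicit Types b c d : A.

Lemma coordsV d b c : coords d b c -> coords d^-1 b c.
Proof. by case=> pd ud pb pc; split=> //; [exact: par_evenV|rewrite unitrV]. Qed.

Lemma coordsZ p q d b c : coords d b c -> coords d (p *: b) (q *: c).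
Proof. by case=> pd ud pb pc; split=> //; exact: parZ. Qed.

Lemma coords_swap d b c : coords d b c -> coords (d * (1 + b * c)) c b.
Proof.
case=> pd ud pb pc; split=> //; first by rewrite par_even // par_odd1D.
by rewrite unitrMl // unit_odd1D.
Qed.

Lemma coords_mul d b c d' b' c' : coords d b c -> coords d' b' c' ->
  coords (d * d' * (1 + c * b')) (b + b') (c + c').
Proof.
case=> pd ud pb pc [pd' ud' pb' pc']; split; try exact: parD.
  by rewrite !par_even ?par_odd1D.
by rewrite !unitrMl // unit_odd1D.
Qed.

Lemma scalar_odd2 p q (b c : A) : (p *: b) * (q *: c) = (p * q) *: (b * c).
Proof. by rewrite -scalerAl -scalerAr scalerA. Qed.

End Slmx.

Section Swap.
Variable A : pzRingType.
Implicit Type g h : 'M[A]_2.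

(** This is conjugation by the permutation matrix, hence multiplicative. *)
Definition swapmx g : 'M[A]_2 := mx22 (g 1 1) (g 1 0) (g 0 1) (g 0 0).

Lemma swapmxM g h : swapmx (g *m h) = swapmx g *m swapmx h.
Proof.
have eta (k : 'M[A]_2) : k = mx22 (k 0 0) (k 0 1) (k 1 0) (k 1 1).
  by apply: mx22_ext; rewrite !mxE.
rewrite (eta g) (eta h) mx22_mul /swapmx !mxE /= mx22_mul.
by congr mx22; rewrite addrC.
Qed.

End Swap.

Lemma swap_slmx (K : numFieldType) (A : superalgebra K) (d b c : A) :
  coords d b c -> swapmx (slmx d b c) = slmx (d * (1 + b * c)) c b.
Proof.
case=> pd ud pb pc; rewrite /swapmx !mxE /=; congr mx22; rewrite -mulrA; last first.
- by rewrite mulrDl mul1r -mulrA (par_oddC pc pb) mulrN mulrA par_oddxx // mul0r oppr0 addr0.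
- by rewrite mulrDl mul1r -mulrA par_oddxx // mulr0 addr0.
by rewrite (par_oddC pc pb) odd_unit1D // mulr1.
Qed.

Section Transformations.
Variable R : realType.
Local Notation C := (R[i]^o).

(** In coordinates [(d, b, c)] goes to [(d, p b, q c)]. The bracket [[E, F] = C] is scaled by [p q],
    which has to be 1 as the centre is fixed. *)
Definition psi_pos (p q : R[i]) : transf R := fun A g =>
  mx22 (g 0 0) (p *: g 0 1) (q *: g 1 0) (g 1 1).

(** In coordinates [(d, b, c)] goes to [(d^-1, p b, q c)]. The centre is inverted, so [C] goes to
    [-C] and [p q = -1]. The entry [d b] becomes [d^-1 (p b)], whence the factor [d^-2]. *)
Definition psi_neg (p q : R[i]) : transf R := fun A g =>
  mx22 (g 0 0)^-1 (p *: (g 1 1 ^- 2 * g 0 1)) (q *: (g 1 1 ^- 2 * g 1 0)) (g 1 1)^-1.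

Definition psi_swap (p q : R[i]) : transf R := fun A g => swapmx (psi_neg p q g).

Lemma psi_pos_slmx p q (A : superpoint R) (d b c : A) : p * q = 1 ->
  psi_pos p q (slmx d b c) = slmx d (p *: b) (q *: c).
Proof.
by move=> pq; rewrite /psi_pos !mxE /= /slmx scalar_odd2 pq scale1r -!scalerAr.
Qed.

Lemma psi_neg_slmx p q (A : superpoint R) (d b c : A) : p * q = -1 ->
  coords d b c -> psi_neg p q (slmx d b c) = slmx d^-1 (p *: b) (q *: c).
Proof.
move=> pq [pd ud pb pc]; rewrite /psi_neg !mxE /= /slmx scalar_odd2 pq scaleN1r.
have e x : d ^- 2 * (d * x) = d^-1 * x.
  by rewrite expr2 invrM // -mulrA mulKr.
rewrite !e -!scalerAr; congr mx22.
rewrite invrM ?unit_odd1D // odd1DV //; apply: par_commr.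
exact: par_evenV.
Qed.

Lemma psi_swap_slmx p q (A : superpoint R) (d b c : A) : p * q = -1 ->
  coords d b c ->
  psi_swap p q (slmx d b c) = slmx (d^-1 * (1 - b * c)) (q *: c) (p *: b).
Proof.
move=> pq h; rewrite /psi_swap psi_neg_slmx // swap_slmx; last exact/coordsZ/coordsV.
by rewrite scalar_odd2 pq scaleN1r.
Qed.

Lemma superfunction_coords (F : forall A : superpoint R, 'M[A]_2 -> A)
    (f0 f1 f2 f12 : C -> C) :
  holomorphic f0 -> holomorphic f1 -> holomorphic f2 -> holomorphic f12 ->
  (forall (A : superpoint R) (d b c : A), coords d b c ->
     F A (slmx d b c) = taylor f0 d + taylor f1 d * (d * b)
       + taylor f2 d * (d * c) + taylor f12 d * (d * b * (d * c))) ->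
  superfunction F.
Proof.
move=> h0 h1 h2 h12 FE; exists f0, f1, f2, f12; split=> // A g.
by move=> /coordsP[d [b [c [h ->]]]]; rewrite FE // !mxE.
Qed.

Let hcst k : holomorphic (fun=> k : C) := @smooth0_cst R[i] k.
Let hid : holomorphic (id : C -> C) := @smooth0_id R[i].
Let hexpV k m : holomorphic (fun z : C => k * z ^- m.+1) := @smooth0_expV R[i] k m.

Lemma psi_pos_holomorphic p q : p * q = 1 -> holomorphic_map (psi_pos p q).
Proof.
move=> pq; split=> [A g /coordsP[d [b [c [h ->]]]]|].
  by rewrite psi_pos_slmx //; apply/SL11_coords/coordsZ.
apply: ord2_ind; apply: ord2_ind.
(* The coefficients are those of [a = d + d^-1 (beta gamma)]. *)
- apply: (superfunction_coords hid (@hcst 0) (@hcst 0) (@hexpV 1 0)) => A d b c [pd ud pb pc].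
  rewrite !mxE /= taylor_id !taylor_cst taylor_expV // !scale0r !mul0r !addr0 scale1r.
  by rewrite -(mulrA d b) mulKr // mulrDr mulr1 (mulrA b) (par_commr b pd) mulrA.
- apply: (superfunction_coords (@hcst 0) (@hcst p) (@hcst 0) (@hcst 0)) => A d b c _.
  by rewrite !mxE /= !taylor_cst !scale0r !mul0r !addr0 add0r -scalerAl mul1r.
- apply: (superfunction_coords (@hcst 0) (@hcst 0) (@hcst q) (@hcst 0)) => A d b c _.
  by rewrite !mxE /= !taylor_cst !scale0r !mul0r !addr0 add0r -scalerAl mul1r.
- apply: (superfunction_coords hid (@hcst 0) (@hcst 0) (@hcst 0)) => A d b c _.
  by rewrite !mxE /= taylor_id !taylor_cst !scale0r !mul0r !addr0.
Qed.

Lemma psi_neg_superfunction p q i j : p * q = -1 ->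
  superfunction (fun A g => @psi_neg p q A g i j).
Proof.
move=> pq; move: i j; apply: ord2_ind; apply: ord2_ind.
(* The coefficients are those of [a^-1 = d^-1 - d^-3 (beta gamma)]. *)
- apply: (superfunction_coords (@hexpV 1 0) (@hcst 0) (@hcst 0) (@hexpV (-1) 2)) => A d b c h.
  have [pd ud pb pc] := h; have pdV := par_evenV pd ud.
  rewrite psi_neg_slmx // !mxE /= !taylor_cst !taylor_expV // !scale0r !mul0r !addr0 scale1r.
  rewrite scalar_odd2 pq !scaleN1r mulrDr mulr1 mulrN mulNr; congr (_ - _).
  rewrite (_ : d * b * (d * c) = d ^+ 2 * (b * c)).
    have u3 : d ^+ 3 \is a GRing.unit by rewrite unitrX.
    by apply: (mulrI u3); rewrite mulVKr // exprSr -mulrA mulVKr.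
  by rewrite mulrA -(mulrA d b) (par_commr b pd) !mulrA.
- apply: (superfunction_coords (@hcst 0) (@hexpV p 1) (@hcst 0) (@hcst 0)) =>
    A d b c [pd ud pb pc].
  by rewrite !mxE /= !taylor_cst !taylor_expV // !scale0r !mul0r !addr0 add0r -scalerAl.
- apply: (superfunction_coords (@hcst 0) (@hcst 0) (@hexpV q 1) (@hcst 0)) =>
    A d b c [pd ud pb pc].
  by rewrite !mxE /= !taylor_cst !taylor_expV // !scale0r !mul0r !addr0 add0r -scalerAl.
- apply: (superfunction_coords (@hexpV 1 0) (@hcst 0) (@hcst 0) (@hcst 0)) =>
    A d b c [pd ud pb pc].
  by rewrite !mxE /= !taylor_cst !taylor_expV // !scale0r !mul0r !addr0 scale1r.
Qed.

Lemma psi_neg_holomorphic p q : p * q = -1 -> holomorphic_map (psi_neg p q).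
Proof.
move=> pq; split=> [A g /coordsP[d [b [c [h ->]]]]|i j].
  by rewrite psi_neg_slmx //; apply/SL11_coords/coordsZ/coordsV.
exact: psi_neg_superfunction.
Qed.

Lemma psi_swap_holomorphic p q : p * q = -1 -> holomorphic_map (psi_swap p q).
Proof.
move=> pq; split=> [A g /coordsP[d [b [c [h ->]]]]|].
  rewrite /psi_swap psi_neg_slmx // swap_slmx; last exact/coordsZ/coordsV.
  exact/SL11_coords/coords_swap/coordsZ/coordsV.
have ext i j i' j' : (forall A g, @psi_swap p q A g i j = @psi_neg p q A g i' j') ->
    superfunction (fun A g => @psi_swap p q A g i j).
  move=> e; have [f0 [f1 [f2 [f12 [h0 h1 h2 h12 E]]]]] := psi_neg_superfunction i' j' pq.
  by exists f0, f1, f2, f12; split=> // A g hg; rewrite e E.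
apply: ord2_ind; apply: ord2_ind; [apply: (ext _ _ 1 1)|apply: (ext _ _ 1 0)|
  apply: (ext _ _ 0 1)|apply: (ext _ _ 0 0)] => A g; by rewrite [LHS]mxE.
Qed.

Lemma psi_pos_mul p q (A : superpoint R) (g h : 'M[A]_2) : p * q = 1 ->
  SL11 g -> SL11 h -> psi_pos p q (g *m h) = psi_pos p q g *m psi_pos p q h.
Proof.
move=> pq /coordsP[d [b [c [k ->]]]] /coordsP[d' [b' [c' [k' ->]]]].
have [pd ud pb pc] := k; have [pd' ud' pb' pc'] := k'.
rewrite slmx_mul // !psi_pos_slmx // slmx_mul //; try exact: parZ.
by rewrite scalar_odd2 mulrC pq scale1r !scalerDr.
Qed.

Lemma psi_neg_mul p q (A : superpoint R) (g h : 'M[A]_2) : p * q = -1 ->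
  SL11 g -> SL11 h -> psi_neg p q (g *m h) = psi_neg p q g *m psi_neg p q h.
Proof.
move=> pq /coordsP[d [b [c [k ->]]]] /coordsP[d' [b' [c' [k' ->]]]].
have [pd ud pb pc] := k; have [pd' ud' pb' pc'] := k'.
have pV := par_evenV pd ud; have pV' := par_evenV pd' ud'.
rewrite slmx_mul // !psi_neg_slmx //; last exact: coords_mul.
rewrite slmx_mul //; try exact: parZ.
rewrite scalar_odd2 (mulrC q) pq scaleN1r !scalerDr; congr slmx.
rewrite !invrM ?unitrMl ?unit_odd1D // odd1DV // (par_commr d'^-1 pV).
by rewrite -(par_commr _ (par_even pV pV')).
Qed.

Lemma psi_pos_automorphism p q : p * q = 1 -> holomorphic_automorphism (psi_pos p q).
Proof.
move=> pq; have pq' : p^-1 * q^-1 = 1 by rewrite -invfM pq invr1.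
have [p0 q0] : p != 0 /\ q != 0.
  by apply/andP; rewrite -negb_or -mulf_eq0 pq oner_neq0.
split; [exact: psi_pos_holomorphic|by move=> A g h; exact: psi_pos_mul|].
exists (psi_pos p^-1 q^-1); first exact: psi_pos_holomorphic.
move=> A _ /coordsP[d [b [c [h ->]]]].
by split; rewrite !psi_pos_slmx // !scalerA ?mulVf ?mulfV // !scale1r.
Qed.

Lemma psi_neg_automorphism p q : p * q = -1 -> holomorphic_automorphism (psi_neg p q).
Proof.
move=> pq; have pq' : p^-1 * q^-1 = -1 by rewrite -invfM pq invrN1.
have [p0 q0] : p != 0 /\ q != 0.
  by apply/andP; rewrite -negb_or -mulf_eq0 pq oppr_eq0 oner_neq0.
split; [exact: psi_neg_holomorphic|by move=> A g h; exact: psi_neg_mul|].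
exists (psi_neg p^-1 q^-1); first exact: psi_neg_holomorphic.
move=> A _ /coordsP[d [b [c [h ->]]]].
have h' s t := coordsZ s t (coordsV h).
by split; rewrite !psi_neg_slmx // invrK !scalerA ?mulVf ?mulfV // !scale1r.
Qed.

Lemma psi_swap_mul p q (A : superpoint R) (g h : 'M[A]_2) : p * q = -1 ->
  SL11 g -> SL11 h -> psi_swap p q (g *m h) = psi_swap p q g *m psi_swap p q h.
Proof. by move=> pq hg hh; rewrite /psi_swap psi_neg_mul // swapmxM. Qed.

(** The odd coordinates change places, so the inverse takes the inverted parameters in the opposite
    order. *)
Lemma psi_swapK p q (A : superpoint R) (g : 'M[A]_2) : p * q = -1 -> SL11 g ->
  psi_swap q^-1 p^-1 (psi_swap p q g) = g.
Proof.
move=> pq /coordsP[d [b [c [h ->]]]].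
have pq' : q^-1 * p^-1 = -1 by rewrite -invfM mulrC pq invrN1.
have [p0 q0] : p != 0 /\ q != 0.
  by apply/andP; rewrite -negb_or -mulf_eq0 pq oppr_eq0 oner_neq0.
have [pd ud pb pc] := h; have pdV := par_evenV pd ud.
have p1B : 1 - b * c \in par false by have := par_odd1D (parN pb) pc; rewrite mulNr.
have u1B : 1 - b * c \is a GRing.unit by have := unit_odd1D (parN pb) pc; rewrite mulNr.
rewrite psi_swap_slmx // psi_swap_slmx //; last first.
  split; [exact: par_even| |exact: parZ|exact: parZ].
  by rewrite unitrMl ?unitrV.
rewrite !scalerA !mulVf // !scale1r scalar_odd2 (mulrC q p) pq scaleN1r opprK.
congr slmx; rewrite invrM ?unitrV // invrK (par_oddC pc pb) (par_commr _ pd).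
by rewrite -mulrA mulVr // mulr1.
Qed.

Lemma psi_swap_automorphism p q : p * q = -1 ->
  holomorphic_automorphism (psi_swap p q).
Proof.
move=> pq; have pq' : q^-1 * p^-1 = -1 by rewrite -invfM mulrC pq invrN1.
split; [exact: psi_swap_holomorphic|by move=> A g h; exact: psi_swap_mul|].
exists (psi_swap q^-1 p^-1); first exact: psi_swap_holomorphic.
move=> A g hg; split; first exact: psi_swapK.
by rewrite -{1}[p]invrK -{1}[q]invrK psi_swapK.
Qed.

Lemma slmx10 (A : pzRingType) : slmx 1 0 0 = 1%:M :> 'M[A]_2.
Proof. by rewrite mx22_scalar /slmx !mulr0 addr0 mulr1. Qed.

Lemma slmx_scalar (A : pzRingType) (d : A) : slmx d 0 0 = d%:M.
Proof. by rewrite mx22_scalar /slmx !mulr0 addr0 mulr1. Qed.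

Lemma slmx_E (A : pzRingType) (t : A) : slmx 1 t 0 = 1%:M + t *: rootvec A false.
Proof.
by apply: mx22_ext; rewrite !mxE /= ?(mulr0, mulr1, mul1r, addr0, add0r, mul0r).
Qed.

Lemma slmx_F (A : pzRingType) (t : A) : slmx 1 0 t = 1%:M + t *: rootvec A true.
Proof.
by apply: mx22_ext; rewrite !mxE /= ?(mulr0, mulr1, mul1r, addr0, add0r, mul0r).
Qed.

Lemma coords_odd (A : superpoint R) (b c : A) : b \in par true -> c \in par true ->
  coords 1 b c.
Proof. by split; rewrite ?unitr1 ?par_one. Qed.

Lemma SL11_rootvec (A : superpoint R) (t : A) i : t \in par true ->
  SL11 (1%:M + t *: rootvec A i).
Proof.
move=> pt; case: i; rewrite -?slmx_E -?slmx_F; apply/SL11_coords/coords_odd => //;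
  exact: par0.
Qed.

(** By left invariance a homomorphism need only be tested at the identity, and the constant [k]
    serves as multiplier at every [g]. *)
Lemma pushes_hom (phi : transf R) i j (k : R[i]) : k != 0 ->
  holomorphic_automorphism phi ->
  (forall (A : superpoint R) (t : A), t \in par true ->
     phi A (1%:M + t *: rootvec A i) = 1%:M + (k *: t) *: rootvec A j) ->
  pushes phi i j.
Proof.
move=> k0 [_ phiM _] phiE A g hg; exists k%:A; split.
- by rewrite parZ ?par_one.
- by rewrite scaler_unit ?unitr1 ?unitfE.
by move=> t pt; rewrite phiM ?phiE -?scalerAr ?mulr1 //; exact: SL11_rootvec.
Qed.

Lemma psi_pos_susy p q : p * q = 1 -> susy_fixing (psi_pos p q).
Proof.
move=> pq; have [p0 q0] : p != 0 /\ q != 0.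
  by apply/andP; rewrite -negb_or -mulf_eq0 pq oner_neq0.
case; [apply: (pushes_hom q0)|apply: (pushes_hom p0)];
  try exact: psi_pos_automorphism; move=> A t pt.
  by rewrite -!slmx_F psi_pos_slmx // scaler0.
by rewrite -!slmx_E psi_pos_slmx // scaler0.
Qed.

Lemma psi_neg_susy p q : p * q = -1 -> susy_fixing (psi_neg p q).
Proof.
move=> pq; have [p0 q0] : p != 0 /\ q != 0.
  by apply/andP; rewrite -negb_or -mulf_eq0 pq oppr_eq0 oner_neq0.
case; [apply: (pushes_hom q0)|apply: (pushes_hom p0)];
  try exact: psi_neg_automorphism; move=> A t pt.
  by rewrite -!slmx_F psi_neg_slmx ?scaler0 ?invr1 //; exact: coords_odd (par0 _ _) pt.
by rewrite -!slmx_E psi_neg_slmx ?scaler0 ?invr1 //; exact: coords_odd pt (par0 _ _).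
Qed.

Lemma psi_swap_susy p q : p * q = -1 -> susy_exchanging (psi_swap p q).
Proof.
move=> pq; have [p0 q0] : p != 0 /\ q != 0.
  by apply/andP; rewrite -negb_or -mulf_eq0 pq oppr_eq0 oner_neq0.
case; [apply: (pushes_hom q0)|apply: (pushes_hom p0)];
  try exact: psi_swap_automorphism; move=> A t pt.
  rewrite -slmx_F -slmx_E psi_swap_slmx ?scaler0 ?invr1 ?mul0r ?subr0 ?mulr1 //.
  exact: coords_odd (par0 _ _) pt.
rewrite -slmx_F -slmx_E psi_swap_slmx ?scaler0 ?invr1 ?mulr0 ?subr0 ?mulr1 //.
exact: coords_odd pt (par0 _ _).
Qed.

End Transformations.

(** * Topology of C and the ordinary points of SL(1|1) *)

Section ComplexTopology.
Local Open Scope complex_scope.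
Variable R : realType.
Local Notation C := (R[i]^o).

(** The norm of [R[i]] takes values in [R[i]]; this is the same number in the totally ordered field
    [R]. *)
Definition cmod (z : C) : R := complex.Re `|z|.

Lemma cmodE (z : C) : (cmod z)%:C = `|z|.
Proof. exact/RRe_real/normr_real. Qed.

Lemma norm_real_complex (x : R) : `|x%:C| = `|x|%:C.
Proof. by rewrite normc_def /= expr0n addr0 sqrtr_sqr. Qed.

Lemma continuous_cmod : continuous cmod.
Proof.
move=> z; apply/(@cvgrPdist_lt _ _ _ (nbhs z) (nbhs_filter z)) => e e0.
apply/nbhs_ballP; exists e%:C => /=.
  by rewrite ltcR.
move=> w; rewrite -ball_normE /= => h; rewrite -ltcR; apply: le_lt_trans h.
apply: le_trans (ler_dist_dist (z : R[i]) w).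
by rewrite -(cmodE z) -(cmodE w) -rmorphB norm_real_complex.
Qed.

Lemma continuous_Complex : continuous (fun x : R * R => (x.1 +i* x.2 : C)).
Proof.
move=> [x y]; apply/(@cvgrPdist_lt _ _ _ (nbhs (x, y)) (nbhs_filter (x, y))) => e e0.
have eE : (complex.Re e)%:C = e by rewrite RRe_real ?gtr0_real.
have e2 : 0 < complex.Re e / 2 by rewrite divr_gt0 // -ltcR eE.
apply/nbhs_ballP; exists (complex.Re e / 2) => // -[x' y'] [/=].
rewrite -!ball_normE /= => hx hy.
have -> : (x +i* y - x' +i* y' : C) = (x - x')%:C + 'i%C * (y - y')%:C :> R[i].
  by rewrite [LHS]complexE /=.
apply: le_lt_trans (ler_normD _ _) _.
have ni : `|'i%C| = 1 :> R[i] by rewrite normc_def /= expr0n expr1n add0r sqrtr1.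
rewrite normrM ni mul1r -eE (splitr (complex.Re e)) [X in _ < X]rmorphD.
by apply: ltrD; rewrite norm_real_complex ltcR.
Qed.

Lemma compact_circle : compact [set z : C | `|z| = 1].
Proof.
pose box := [set x : R * R | `[(-1)%R, 1%R]%classic x.1 /\ `[(-1)%R, 1%R]%classic x.2].
have cbox : compact box.
  by apply: compact_setX; exact: segment_compact.
have cC : compact ((fun x : R * R => (x.1 +i* x.2 : C)) @` box).
  apply: continuous_compact cbox; apply: continuous_subspaceT.
  exact: continuous_Complex.
apply: subclosed_compact cC _.
  have -> : [set z : C | `|z| = 1] = cmod @^-1` [set 1].
    apply/seteqP; split=> z /= h; first by apply: complexI; rewrite cmodE h.
    by rewrite -cmodE h.
  apply: closed_comp => [z _|]; first exact: continuous_cmod.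
  exact: closed_eq.
move=> [x y] /= h; exists (x, y) => //; rewrite /box /= !in_itv /= -!ler_norml.
have ni : `|'i%C| = 1 :> R[i] by rewrite normc_def /= expr0n expr1n add0r sqrtr1.
(* The real part of [i z] is minus the imaginary part of [z], so one inequality bounds both
   coordinates. *)
have := normc_ge_Re (x +i* y); have := normc_ge_Re ('i%C * (x +i* y) : R[i]).
have h' : `|x +i* y : R[i]| = 1 := h.
rewrite normrM ni mul1r h' !lecR /= mul0r mul1r sub0r normrN.
by move=> hy hx; split.
Qed.

Lemma continuous_scalar_mx n : continuous (fun z : C => z%:M : 'M[C]_n).
Proof.
move=> z A /nbhs_ballP[e e0 hA]; apply/nbhs_ballP; exists e => // w zw; apply: hA.
split=> // i j; rewrite !mxE; case: (i == j) => //=.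
exact: ballxx.
Qed.

Lemma compact_diag_bounded n (K : set 'M[C]_n.+1) (i j : 'I_n.+1) : compact K ->
  exists M : R, forall g, K g -> cmod (g i j) <= M.
Proof.
move=> cK.
have : compact ((fun g : 'M[C]_n.+1 => cmod (g i j)) @` K).
  apply: continuous_compact cK; apply: continuous_subspaceT => g.
  apply: continuous_comp; last exact: continuous_cmod.
  exact: (@coord_continuous R[i] _ _ i j).
move=> /compact_bounded[M [_ hM]]; exists (M + 1) => g Kg.
apply: le_trans (ler_norm _) _; apply: (hM (M + 1)); first by rewrite ltrDl.
by exists g.
Qed.

(** If the modulus is [1 + x] with [x > 0], Bernoulli's inequality bounds the powers from below by
    [1 + n x]. *)
Lemma bounded_powers (z : C) (M : R) : (forall n, cmod (z ^+ n) <= M) -> `|z| <= 1.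
Proof.
move=> h; rewrite -cmodE lecR leNgt; apply/negP => z1.
pose x := cmod z - 1; have x0 : 0 < x by rewrite subr_gt0.
have hx : 1 + x = cmod z by rewrite addrC subrK.
have bern n : 1 + n%:R * x <= (1 + x) ^+ n.
  elim: n => [|n IH]; first by rewrite mul0r addr0 expr0.
  apply: (@le_trans _ _ ((1 + n%:R * x) * (1 + x))); last first.
    by rewrite exprSr ler_wpM2r // addr_ge0 // ltW.
  have -> : (1 + n%:R * x) * (1 + x) = 1 + n.+1%:R * x + n%:R * x * x.
    by rewrite -natr1; ring.
  by rewrite lerDl !mulr_ge0 ?ler0n // ltW.
have hc n : cmod (z ^+ n) = (1 + x) ^+ n.
  by apply: complexI; rewrite cmodE hx rmorphXn /= cmodE normrX.
have := le_trans (bern (Num.truncn (M / x)).+1) _.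
move=> /(_ M); rewrite -hc => /(_ (h _)); apply/negP; rewrite -ltNge.
apply: (@lt_trans _ _ ((Num.truncn (M / x)).+1%:R * x)); last by rewrite ltrDr.
by rewrite -ltr_pdivrMr // truncnS_gt.
Qed.

End ComplexTopology.

Section OrdinaryPoints.
Local Open Scope complex_scope.
Variable R : realType.
Local Notation C := (R[i]^o).

(** At the ordinary point odd entries vanish and [a = d], so these matrices with [z != 0] are the
    whole reduced group. *)
Definition ptmx (z : R[i]) : 'M[pt R]_2 := (z : pt R)%:M.

Lemma ptmx_inj z w : ptmx z = ptmx w -> z = w.
Proof. by move=> /matrixP/(_ 1 1); rewrite !mxE. Qed.

Lemma ptmxM z w : ptmx z *m ptmx w = ptmx (z * w).
Proof. by rewrite /ptmx -scalar_mxM. Qed.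

Lemma SL11_scalar (A : superpoint R) (d : A) : d \in par false ->
  d \is a GRing.unit -> SL11 (d%:M : 'M[A]_2).
Proof.
by move=> pd ud; rewrite -slmx_scalar; apply: SL11_coords; split; rewrite ?par0.
Qed.

Lemma SL11_ptmx z : z != 0 -> SL11 (ptmx z).
Proof. by move=> z0; apply: SL11_scalar => //; rewrite unitfE. Qed.

Lemma SL11_ptmxP (g : 'M[pt R]_2) : SL11 g -> exists2 z, z != 0 & g = ptmx z.
Proof.
move=> /coordsP[d [b [c [[_ ud /eqP pb /eqP pc] ->]]]].
exists d; first by rewrite -unitfE.
by rewrite pb pc slmx_scalar.
Qed.

Lemma cconj_ptmx z : cconj (ptmx z) = ptmx z^*.
Proof. by rewrite /cconj /ptmx map_scalar_mx. Qed.

Lemma taylor_pt (f : C -> C) (z : pt R) : taylor f z = f z.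
Proof.
have := @taylor_scalar R (pt R) f z.
by rewrite /GRing.scale /= !mulr1.
Qed.

End OrdinaryPoints.

Section RealPoints.
Local Open Scope complex_scope.
Variables (R : realType) (A : real_superpoint R).
Implicit Types (b c d : A).

Lemma cconj_mx22 (a b c d : A) :
  cconj (mx22 a b c d) = mx22 (bar A a) (bar A b) (bar A c) (bar A d).
Proof. by apply: mx22_ext; rewrite !mxE. Qed.

Lemma cconj_slmx d b c : cconj (slmx d b c) = slmx (bar A d) (bar A b) (bar A c).
Proof. by rewrite cconj_mx22 !rmorphM rmorphD rmorph1 rmorphM. Qed.

Lemma coords_bar d b c : coords d b c -> coords (bar A d) (bar A b) (bar A c).
Proof.
by case=> pd ud pb pc; split; [exact: bar_par|exact: rmorph_unit|exact: bar_par|exact: bar_par].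
Qed.

Lemma SL11_cconj (g : 'M[A]_2) : SL11 g -> SL11 (cconj g).
Proof.
by move=> /coordsP[d [b [c [h ->]]]]; rewrite cconj_slmx; exact/SL11_coords/coords_bar.
Qed.

Lemma cconjM (g h : 'M[A]_2) : cconj (g *m h) = cconj g *m cconj h.
Proof. exact: map_mxM. Qed.

End RealPoints.

(** * Normal form of a real structure that exchanges the distributions *)

Section ReducedGroup.
Local Open Scope complex_scope.
Variables (R : realType) (tau : real_transf R) (theta : transf R).
Arguments tau : clear implicits.
Arguments theta : clear implicits.
Hypothesis tau_real : real_structure tau.
Hypothesis tau_compact : compact (reduced_real_form tau).
Hypothesis theta_hom : holomorphic_automorphism theta.
Hypothesis theta_tau : conj_comp theta tau.
Local Notation C := (R[i]^o).

(** A scalar matrix has no odd entries, so only the first term of the superfunction expansion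
    survives. *)
Lemma theta_scalar_entry i j : exists2 f : C -> C, holomorphic f &
  forall (A : superpoint R) (d : A), d \in par false -> d \is a GRing.unit ->
    theta A d%:M i j = taylor f d.
Proof.
have [[_ sf] _ _] := theta_hom.
have [f0 [f1 [f2 [f12 [h0 _ _ _ E]]]]] := sf i j.
exists f0 => // A d pd ud; rewrite E; last exact: SL11_scalar.
by rewrite !mxE /= mulr0 !mulr0 !addr0.
Qed.

Lemma theta_ptmx : exists2 chi : C -> C,
  (forall z, z != 0 -> chi z != 0) &
  forall z, z != 0 -> theta (pt R) (ptmx z) = ptmx (chi z).
Proof.
have [[sl _] _ _] := theta_hom.
exists (fun z => theta (pt R) (ptmx z) 1 1) => z z0;
  have [w w0 ->] := SL11_ptmxP (sl _ _ (SL11_ptmx z0)); by rewrite !mxE.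
Qed.

Section Character.
Variable chi : C -> C.
Hypothesis chi_neq0 : forall z, z != 0 -> chi z != 0.
Hypothesis chiE : forall z, z != 0 -> theta (pt R) (ptmx z) = ptmx (chi z).

Lemma chiM (z w : C) : z != 0 -> w != 0 -> chi (z * w) = chi z * chi w.
Proof.
move=> z0 w0; have [_ hM _] := theta_hom.
apply: ptmx_inj; rewrite -chiE ?mulf_neq0 // -ptmxM hM ?chiE //; first exact: ptmxM.
  exact: SL11_ptmx.
exact: SL11_ptmx.
Qed.

Lemma tau_ptmx z : z != 0 -> tau (pt R) (ptmx z) = ptmx (chi z)^*.
Proof. by move=> z0; rewrite theta_tau ?chiE ?cconj_ptmx //; exact: SL11_ptmx. Qed.

(* z conj(chi z) is fixed by the real structure; so are its powers, which
   therefore stay bounded. *)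
Lemma norm_chi_le z : z != 0 -> `|z * chi z| <= 1.
Proof.
move=> z0; have [_ tauM tauK] := tau_real; pose w := z * (chi z)^*.
have s0 : (chi z)^* != 0 by rewrite conjc_eq0 chi_neq0.
have w0 : w != 0 by rewrite mulf_neq0.
(* [ptmx w] is [ptmx z] times its image under [tau]. The involution exchanges the two factors, which
   commute. *)
have fixw : tau (pt R) (ptmx w) = ptmx w.
  rewrite -ptmxM tauM; [|exact: SL11_ptmx..].
  rewrite {1}tau_ptmx // -[in X in _ *m X](tau_ptmx z0) tauK ?ptmxM ?(mulrC _ z) //.
  exact: SL11_ptmx.
have fixwn n : tau (pt R) (ptmx (w ^+ n.+1)) = ptmx (w ^+ n.+1).
  elim: n => [|n IH]; first by rewrite expr1.
  rewrite exprS -ptmxM tauM ?fixw ?IH //; apply: SL11_ptmx => //.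
  exact: expf_neq0.
have [M hM] := @compact_diag_bounded R 1 _ 1 1 tau_compact.
have -> : `|z * chi z| = `|w| :> R[i] by rewrite !normrM normcJ.
(* The bound 1 takes care of the exponent 0, which [fixwn] does not cover. *)
apply: (@bounded_powers R w (Num.max 1 M)) => -[|n].
  by rewrite expr0 le_max -lecR cmodE normr1 lexx.
have := hM (ptmx (w ^+ n.+1)) (conj (SL11_ptmx (expf_neq0 _ w0)) (fixwn n)).
by rewrite mxE /= mulr1n => h; rewrite le_max h orbT.
Qed.

Lemma chi1 : chi 1 = 1.
Proof.
have n1 : (1 : C) != 0 := oner_neq0 _.
by apply: (mulfI (chi_neq0 n1)); rewrite -chiM // !mulr1.
Qed.

(** The upper bound also holds at [z^-1], where the value is the inverse of the one at [z]. *)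
Lemma norm_chi z : z != 0 -> `|z * chi z| = 1.
Proof.
move=> z0; have zV0 : z^-1 != 0 by rewrite invr_eq0.
apply: le_anti; rewrite norm_chi_le //=.
have e : z * chi z * (z^-1 * chi z^-1) = 1.
  by rewrite mulrACA -chiM // mulfV // chi1 mulr1.
have n0 : 0 < `|z^-1 * chi z^-1| by rewrite normr_gt0 mulf_neq0 // chi_neq0.
rewrite -(ler_pM2r n0) -normrM e normr1 mul1r.
exact: norm_chi_le.
Qed.

End Character.

(** Each entry is the Taylor expansion of one holomorphic function. At the ordinary point this
    function is seen to be [z^-1] on the diagonal and 0 off it, and its derivatives determine the
    entry at every even unit [d]. *)
Lemma theta_scalar (A : superpoint R) (d : A) : d \in par false ->
  d \is a GRing.unit -> theta A d%:M = (d^-1)%:M.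
Proof.
move=> pd ud; have [chi chi0 chiE] := theta_ptmx.
have entry i j (f : C -> C) : (forall (B : superpoint R) (x : B), x \in par false ->
    x \is a GRing.unit -> theta B x%:M i j = taylor f x) ->
    forall z : C, z != 0 -> f z = (chi z) *+ (i == j).
  move=> fE z z0; have := fE (pt R) z isT; rewrite unitfE => /(_ z0).
  by rewrite -/(ptmx z) chiE // !mxE taylor_pt => <-.
have [f00 _ E00] := theta_scalar_entry 0 0; have [f01 _ E01] := theta_scalar_entry 0 1.
have [f10 _ E10] := theta_scalar_entry 1 0; have [f11 h11 E11] := theta_scalar_entry 1 1.
have e11 z : z != 0 -> f11 z = chi z by move=> z0; rewrite (entry 1 1 f11 E11).
have chiV z : z != 0 -> chi z = z^-1.
  move=> z0; rewrite -e11 //; apply: holomorphic_hom_inv => // [u v u0 v0|u u0].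
    by rewrite !e11 ?mulf_neq0 // (chiM chiE).
  by rewrite e11 // (norm_chi chi0 chiE).
have diag i f : (forall (B : superpoint R) (x : B), x \in par false ->
    x \is a GRing.unit -> theta B x%:M i i = taylor f x) -> theta A d%:M i i = d^-1.
  move=> fE; rewrite fE // -[RHS]scale1r -(taylor_expV 1 0 ud).
  apply: taylor_eq => // z z0; rewrite (entry _ _ _ fE) // eqxx chiV //.
  by rewrite expr1 mul1r.
have off i j f : i != j -> (forall (B : superpoint R) (x : B), x \in par false ->
    x \is a GRing.unit -> theta B x%:M i j = taylor f x) -> theta A d%:M i j = 0.
  move=> ij fE; rewrite fE // -[RHS](scale0r (1 : A)) -(@taylor_cst R A 0 d).
  by apply: taylor_eq => // z z0; rewrite (entry _ _ _ fE) // (negbTE ij).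
apply: mx22_ext; rewrite mxE /=.
- exact: diag E00.
- exact: off E01.
- exact: off E10.
- exact: diag E11.
Qed.

Hypothesis theta_exch : susy_exchanging theta.

Lemma theta_exchange_E : exists la : R[i], forall (A : superpoint R) (t : A),
  t \in par true -> theta A (slmx 1 t 0) = slmx 1 0 (la *: t).
Proof.
have [[_ sf] _ _] := theta_hom.
have [f0 [f1 [f2 [f12 [h0 _ _ _ E]]]]] := sf 1 0.
(* The multiplier supplied by [pushes] depends on [A], whereas the coefficient [f1] is common to all
   superpoints. The constant term [f0 1] vanishes because the identity is fixed. *)
exists (f1 1) => A t pt.
have p0 := par0 A true.
have h1 : @SL11 _ A 1%:M by rewrite -slmx10; apply/SL11_coords/coords_odd.
have t1 : theta A 1%:M = 1%:M.
  by rewrite theta_scalar ?par_one ?unitr1 // invr1.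
have [h [_ _ hE]] := theta_exch false h1; have := hE t pt.
rewrite mul1mx t1 mul1mx -slmx_E -slmx_F => et; rewrite et; congr slmx.
have := E A _ (SL11_coords (coords_odd pt p0)); rewrite et !mxE /= !mul1r !mulr0 !addr0.
rewrite !taylor1 -scalerAl mul1r => ->.
have := E A _ h1; rewrite t1 !mxE /= !mulr0 !addr0 taylor1 => <-.
by rewrite add0r.
Qed.

Lemma theta_exchange_F : exists mu : R[i], forall (A : superpoint R) (t : A),
  t \in par true -> theta A (slmx 1 0 t) = slmx 1 (mu *: t) 0.
Proof.
have [[_ sf] _ _] := theta_hom.
have [f0 [f1 [f2 [f12 [h0 _ _ _ E]]]]] := sf 0 1.
exists (f2 1) => A t pt.
have p0 := par0 A true.
have h1 : @SL11 _ A 1%:M by rewrite -slmx10; apply/SL11_coords/coords_odd.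
have t1 : theta A 1%:M = 1%:M.
  by rewrite theta_scalar ?par_one ?unitr1 // invr1.
have [h [_ _ hE]] := theta_exch true h1; have := hE t pt.
rewrite mul1mx t1 mul1mx -slmx_E -slmx_F => et; rewrite et; congr slmx.
have := E A _ (SL11_coords (coords_odd p0 pt));
rewrite et !mxE /= !mul1r !mulr0 !mul0r !mulr0 !addr0.
rewrite !taylor1 -scalerAl mul1r => ->.
have := E A _ h1; rewrite t1 !mxE /= !mulr0 !addr0 taylor1 => <-.
by rewrite add0r.
Qed.

Lemma theta_form : exists la mu : R[i],
  [/\ la * mu = -1, mu^* * la = 1 & forall (A : superpoint R) (d b c : A), coords d b c ->
        theta A (slmx d b c) = slmx (d^-1 * (1 - b * c)) (mu *: c) (la *: b)].
Proof.
have [la laE] := theta_exchange_E; have [mu muE] := theta_exchange_F.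
have [_ hM _] := theta_hom; have [_ tauM tauK] := tau_real.
have EF (A : superpoint R) (b c : A) : b \in par true -> c \in par true ->
    slmx 1 b 0 *m slmx 1 0 c = slmx 1 b c.
  move=> pb pc; rewrite slmx_mul ?par_one ?par0 //.
  by rewrite mulr1 mul1r mul0r addr0 addr0 add0r.
have form (A : superpoint R) (d b c : A) : coords d b c ->
    theta A (slmx d b c) = slmx (d^-1 * (1 + (la * mu) *: (b * c))) (mu *: c) (la *: b).
  move=> [pd ud pb pc]; have p0 := par0 A true.
  have hb := coords_odd pb p0; have hc := coords_odd p0 pc.
  have -> : slmx d b c = d%:M *m slmx 1 b c.
    by rewrite mx22_scalar mx22_mul /slmx !mul0r !addr0 !add0r !mul1r mulr1.
  rewrite -EF // hM; [|exact: SL11_scalar|rewrite EF //; exact/SL11_coords/coords_odd].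
  rewrite hM; [|exact: SL11_coords..].
  rewrite theta_scalar // laE // muE // slmx_mul ?par_one ?par0 ?parZ //.
  rewrite !mul1r addr0 add0r scalar_odd2.
  by rewrite mx22_scalar mx22_mul /slmx !mul0r !addr0 !add0r !mulrA.
have [A [b [c [pb pc bc0]]]] := odd_product_neq0 R.
have p0 := par0 A true.
(* Compute [theta] on [exp (c F) exp (b E)], whose even coordinate is [1 + c b]. The homomorphism
   property gives an image with even coordinate 1, the formula [form] gives
   [(1 + c b)^-1 (1 + la mu b c)]. *)
have lamu : la * mu = -1.
  have hb := coords_odd pb p0; have hc := coords_odd p0 pc.
  have := hM A _ _ (SL11_coords hc) (SL11_coords hb).
  rewrite slmx_mul ?par_one ?par0 // laE // muE // EF ?parZ //.
  rewrite !mul1r addr0 add0r form; last first.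
    split=> //; [exact: par_odd1D|exact: unit_odd1D].
  case/mx22_inj=> _ _ _ e.
  have u := unit_odd1D pc pb; have := congr1 (fun x => (1 + c * b) * x) e.
  rewrite mulVKr // mulr1 => /addrI; rewrite (par_oddC pc pb) => /eqP.
  rewrite -subr_eq0 opprK -[X in _ + X]scale1r -scalerDl.
  rewrite scaler_eq0 (negbTE bc0) orbF addr_eq0 => /eqP //.
exists la, mu; split=> //.
  (* Applying [tau] twice to [exp (b E)] multiplies [b] by [mu^* * la]. *)
  have hb := coords_odd pb p0.
  have := tauK A _ (SL11_coords hb); rewrite (theta_tau (SL11_coords hb)) laE //.
  rewrite cconj_slmx !rmorph0 rmorph1 bar_scale.
  have pb' : la^* *: bar A b \in par true by rewrite parZ // bar_par.
  rewrite (theta_tau (SL11_coords (coords_odd p0 pb'))) muE // cconj_slmx.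
  rewrite !rmorph0 rmorph1 !bar_scale bar_invol conjcK scalerA => e.
  have [_ eb _] := slmx_inj (unitr1 _) e.
  have b0 : b != 0 by apply: contra_neq bc0 => ->; rewrite mul0r.
  apply/eqP; rewrite -subr_eq0; move/eqP: eb.
  by rewrite -subr_eq0 -[X in _ - X]scale1r -scalerBl scaler_eq0 (negbTE b0) orbF.
by move=> B d b' c' h; rewrite form // lamu scaleN1r.
Qed.

End ReducedGroup.

(** * The compact real form *)

Section CompactRealForm.
Variable R : realType.
Local Notation C := (R[i]^o).
Local Notation "x ^*" := (conjc x) : ring_scope.
Local Notation i := ('i%C : R[i]).

Definition compact_sigma : real_transf R := fun A g =>
  mx22 (bar A (g 1 1))^-1
       (- i *: (bar A (g 0 0) ^- 2 * bar A (g 1 0)))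
       (- i *: (bar A (g 0 0) ^- 2 * bar A (g 0 1)))
       (bar A (g 0 0))^-1.

Lemma mul_i_i : i * i = -1. Proof. by rewrite -expr2 sqr_i. Qed.

Lemma conj_i : i^* = - i. Proof. by apply/eqP; rewrite eq_complex /= oppr0 !eqxx. Qed.

Lemma i_inv : i^-1 = - i.
Proof.
have i0 : i != 0 by rewrite eq_complex /= oner_eq0 andbF.
by apply: (mulfI i0); rewrite mulfV // mulrN mul_i_i opprK.
Qed.

(** The inverse of [a] is [d^-1 (1 - b c)], and [1 - b c] acts as 1 on multiples of [b] or [c]. This
    reconciles the factor [a^-2] of [compact_sigma] with the [d^-2] of [psi_neg]; [1 - j] is the
    off-diagonal column of row [j]. *)
Lemma SL11_diag_inv (A : superpoint R) (g : 'M[A]_2) j : SL11 g ->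
  g 0 0 ^- 2 * g j (1 - j) = g 1 1 ^- 2 * g j (1 - j).
Proof.
move=> /coordsP[d [b [c [[pd ud pb pc] ->]]]].
have pV := par_evenV pd ud.
have aV : (d * (1 + b * c))^-1 = d^-1 * (1 - b * c).
  by rewrite invrM ?unit_odd1D // odd1DV //; exact: (par_commr _ pV).
have ua : d * (1 + b * c) \is a GRing.unit by rewrite unitrMl // unit_odd1D.
have absorb y x : y \in par false -> b * c * x = 0 ->
    d^-1 * (1 - b * c) * (y * x) = d^-1 * (y * x).
  move=> py bcx; rewrite -mulrA; congr (_ * _).
  by rewrite mulrBl mul1r mulrA (par_commr _ py) -(mulrA y) bcx mulr0 subr0.
have absorb2 x : b * c * x = 0 ->
    (d * (1 + b * c)) ^- 2 * (d * x) = d ^- 2 * (d * x).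
  move=> bcx; rewrite !expr2 (invrM ua ua) (invrM ud ud) aV.
  set k := d^-1 * (1 - b * c).
  rewrite -(mulrA k) (absorb d x) // -(mulrA d^-1) mulKr //.
  by have := absorb 1 x (par_one _) bcx; rewrite !mul1r.
move: j; apply: ord2_ind; rewrite !mxE /=.
  rewrite absorb2 // -mulrA (par_oddC pc pb) mulrN mulrA par_oddxx // mul0r oppr0 //.
by rewrite absorb2 // -mulrA par_oddxx // mulr0.
Qed.

Lemma SL11_mul (A : superpoint R) (g h : 'M[A]_2) : SL11 g -> SL11 h -> SL11 (g *m h).
Proof.
move=> /coordsP[d [b [c [k ->]]]] /coordsP[d' [b' [c' [k' ->]]]].
have [pd ud pb pc] := k; have [pd' ud' pb' pc'] := k'.
by rewrite slmx_mul //; exact/SL11_coords/coords_mul.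
Qed.

Lemma cconjK (A : real_superpoint R) : involutive (@cconj R A).
Proof. by move=> g; apply: mx22_ext; rewrite !mxE bar_invol. Qed.

Lemma compact_sigma_conj : conj_comp (psi_swap i i) compact_sigma.
Proof.
move=> A g hg; have [[_ ua] [_ ud] _ _ _] := hg.
rewrite /psi_swap /psi_neg /swapmx !mxE /= cconj_mx22 /compact_sigma.
rewrite !bar_scale conj_i -!rmorphV //.
have e0 := SL11_diag_inv 0 hg; have e1 := SL11_diag_inv 1 hg.
rewrite subr0 in e0; rewrite subrr in e1.
have aV2 : bar A (g 0 0 ^- 2) = bar A (g 0 0) ^- 2.
  by rewrite rmorphV ?unitrX // rmorphXn.
by rewrite -e0 -e1 !rmorphM aV2.
Qed.

Lemma cconj_psi_swap p q (A : real_superpoint R) (g : 'M[A]_2) : p * q = -1 -> SL11 g ->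
  cconj (psi_swap p q g) = psi_swap p^* q^* (cconj g).
Proof.
move=> pq /coordsP[d [b [c [h ->]]]]; have [pd ud pb pc] := h.
have pq' : p^* * q^* = -1 by rewrite -rmorphM pq rmorphN1.
rewrite psi_swap_slmx // !cconj_slmx psi_swap_slmx //; last exact: coords_bar.
by rewrite !bar_scale rmorphM rmorphV // rmorphB rmorph1 rmorphM.
Qed.

Lemma compact_sigma_real : real_structure compact_sigma.
Proof.
have [hol hM _] := psi_swap_automorphism mul_i_i; have [hS _] := hol.
split.
- by exists (psi_swap i i); [exact: hol|exact: compact_sigma_conj].
- move=> A g h hg hh.
  by rewrite !compact_sigma_conj ?hM ?cconjM //; exact: SL11_mul.
move=> A g hg; have hs := hS A g hg.
rewrite (compact_sigma_conj hg) (compact_sigma_conj (SL11_cconj hs)).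
rewrite cconj_psi_swap ?mul_i_i //; last exact: SL11_cconj.
(* The choice [p = q = i] works because the conjugate [-i] is also [i^-1]: conjugating
   [psi_swap i i] gives its inverse. *)
by rewrite cconjK conj_i -i_inv psi_swapK ?mul_i_i.
Qed.

Lemma compact_sigma_ptmx z : z != 0 ->
  compact_sigma (ptmx z : 'M[pt R]_2) = ptmx (z^*)^-1.
Proof.
move=> z0; have h : coords (z : pt R) 0 0 by split; rewrite ?unitfE ?par0.
rewrite (compact_sigma_conj (SL11_ptmx z0)) /ptmx -slmx_scalar psi_swap_slmx ?mul_i_i //.
by rewrite mul0r subr0 mulr1 !scaler0 slmx_scalar [LHS]cconj_ptmx -conjc_inv.
Qed.

(** On [C^*] the involution sends [z] to the inverse of its conjugate, so the fixed group is the
    unit circle. *)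
Lemma compact_sigma_compact : compact (reduced_real_form compact_sigma).
Proof.
have -> : reduced_real_form compact_sigma =
    (fun z : C => z%:M) @` [set z : C | `|z| = 1].
  apply/seteqP; split=> [g [hg sg]|_ [z /= z1 <-]].
    have [z z0 e] := SL11_ptmxP hg; exists z => //=.
    move: sg; rewrite e compact_sigma_ptmx // => /ptmx_inj zz.
    have : `|z| ^+ 2 = 1 :> R[i].
      by rewrite sqr_normc -{1}zz mulVf // conjc_eq0.
    by move/eqP; rewrite sqrp_eq1 // => /eqP.
  have z0 : z != 0 by rewrite -normr_gt0 z1 ltr01.
  split; first exact: SL11_ptmx.
  rewrite [LHS]compact_sigma_ptmx //; congr ptmx.
  have zz : z * z^* = 1 :> R[i] by rewrite -sqr_normc [`|z|]z1 expr1n.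
  have zc0 : z^* != 0 by rewrite conjc_eq0.
  by apply: (mulIf zc0); rewrite mulVf.
apply: continuous_compact (@compact_circle R).
exact/continuous_subspaceT/continuous_scalar_mx.
Qed.

Lemma compact_sigma_slmx (A : real_superpoint R) (d b c : A) : coords d b c ->
  compact_sigma (slmx d b c) =
  slmx ((bar A d)^-1 * (1 - bar A b * bar A c)) (- i *: bar A c) (- i *: bar A b).
Proof.
move=> h; have [pd ud pb pc] := h.
rewrite (compact_sigma_conj (SL11_coords h)) psi_swap_slmx ?mul_i_i //.
by rewrite cconj_slmx !bar_scale conj_i rmorphM rmorphV // rmorphB rmorph1 rmorphM.
Qed.

End CompactRealForm.

Theorem theorem4p3 (R : realType) :
  exists sigma : real_transf R,
    [/\ real_structure sigma /\ compact (reduced_real_form sigma),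
        exists phi : transf R,
          [/\ holomorphic_automorphism phi, susy_preserving phi
            & conj_comp phi sigma],
        forall (A : real_superpoint R) (a b c d : A), SL11 (mx22 a b c d) ->
          sigma A (mx22 a b c d) =
          mx22 (bar A d)^-1
               (- ('i%C : R[i]) *: (bar A a ^- 2 * bar A c))
               (- ('i%C : R[i]) *: (bar A a ^- 2 * bar A b))
               (bar A a)^-1
      & forall (tau : real_transf R) (theta : transf R),
          real_structure tau -> compact (reduced_real_form tau) ->
          holomorphic_automorphism theta -> susy_exchanging theta ->
          conj_comp theta tau ->
          isomorphic_real_forms sigma tau].
Proof.
exists (@compact_sigma R); split.
- by split; [exact: compact_sigma_real|exact: compact_sigma_compact].
- exists (psi_swap 'i%C 'i%C); split; first exact: psi_swap_automorphism (mul_i_i R).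
    by right; exact: psi_swap_susy (mul_i_i R).
  exact: compact_sigma_conj.
- by move=> A a b c d _; rewrite /compact_sigma !mxE.
move=> tau theta tau_real tau_compact theta_hom theta_exch theta_tau.
have [la [mu [lamu mula thetaE]]] :=
  theta_form tau_real tau_compact theta_hom theta_tau theta_exch.
have la0 : la != 0 by apply: contra_eq_neq lamu => ->; rewrite mul0r eq_sym oppr_eq0 oner_eq0.
(* Both sides are the inverse of [la]. *)
have muN : conjc mu = - mu.
  by apply: (mulIf la0); rewrite mula mulNr mulrC lamu opprK.
pose m := complex.Im mu.
have muE : mu = 'i%C * m%:C%C.
  rewrite [LHS]complexE -/m.
  suff -> : complex.Re mu = 0 by rewrite add0r.
  have : complex.Re mu = - complex.Re mu by have := congr1 (@complex.Re R) muN; case: (mu).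
  by move=> h; lra.
have m0 : m != 0.
  apply: contra_eq_neq mula => m0; rewrite muE m0 rmorph0 mulr0 rmorph0 mul0r eq_sym.
  exact: oner_neq0.
pose r := Num.sqrt `|m|.
have r0 : r != 0 by rewrite sqrtr_eq0 -ltNge normr_gt0.
have rr : r * r = `|m| by rewrite -expr2 sqr_sqrtr.
(* For real [p] and [q] the intertwining relations [e1] and [e2] both say [p = m q]. An automorphism
   needs [p q = 1] or [p q = -1], which forces [q ^+ 2] to be the inverse of [|m|]. *)
pose q : R[i] := (r^-1)%:C%C; pose p : R[i] := (m / r)%:C%C.
have pq : p * q = (Num.sg m)%:C%C.
  by rewrite -rmorphM /= -mulrA -invfM rr {1}[m]numEsg mulfK ?normr_eq0.
have cq : conjc q = q := conjc_real _.
have cp : conjc p = p := conjc_real _.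
have e1 : p * - 'i%C = conjc mu * q.
  by rewrite muN muE mulNr mulrN -mulrA mulrC /p /q -rmorphM.
have e2 : q * - 'i%C = conjc la * p.
  have lm : conjc la * mu = 1.
    by rewrite -[mu]conjcK -(rmorphM (@conjc R)) mulrC mula rmorph1.
  rewrite -[LHS]mul1r -lm {1}muE /p rmorphM -/q -[LHS]mulrA; congr (_ * _).
  transitivity (- ('i%C * 'i%C) * (m%:C%C * q)); first by ring.
  by rewrite mul_i_i opprK mul1r.
have tauE (A : real_superpoint R) (d b c : A) : coords d b c ->
    tau A (slmx d b c) = slmx ((bar A d)^-1 * (1 - bar A b * bar A c))
      (conjc mu *: bar A c) (conjc la *: bar A b).
  move=> h; have [pd ud pb pc] := h.
  rewrite (theta_tau _ _ (SL11_coords h)) thetaE // cconj_slmx !bar_scale.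
  by rewrite rmorphM rmorphV // rmorphB rmorph1 rmorphM.
(* As [p q] is the sign of [m], the sign decides whether the isomorphism fixes or inverts the
   centre. *)
have [msg|msg] : Num.sg m = 1 \/ Num.sg m = -1.
- by move: m0; case: sgrP => // _ _; [left|right].
- have pq1 : p * q = 1 by rewrite pq msg.
  exists (psi_pos p q); split; first exact: psi_pos_automorphism.
    by left; exact: psi_pos_susy.
  move=> A _ /coordsP[d [b [c [h ->]]]].
  rewrite compact_sigma_slmx // !psi_pos_slmx // tauE; last exact: coordsZ.
  by rewrite !bar_scale cp cq scalar_odd2 pq1 scale1r !scalerA e1 e2.
- have pqN : p * q = -1 by rewrite pq msg rmorphN1.
  exists (psi_neg p q); split; first exact: psi_neg_automorphism.
    by left; exact: psi_neg_susy.
  move=> A _ /coordsP[d [b [c [h ->]]]]; have hb := coords_bar h.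
  have [pd ud pb pc] := h; have [pd' ud' pb' pc'] := hb.
  have u1B : 1 - bar A b * bar A c \is a GRing.unit.
    by rewrite -mulNr unit_odd1D // parN.
  have hs : coords ((bar A d)^-1 * (1 - bar A b * bar A c))
      (- 'i%C *: bar A c) (- 'i%C *: bar A b).
    split; try exact: parZ; last by rewrite unitrMl ?unitrV.
    by rewrite par_even ?par_evenV // -mulNr par_odd1D // parN.
  rewrite compact_sigma_slmx // (psi_neg_slmx pqN hs) (psi_neg_slmx pqN h).
  rewrite tauE; last exact/coordsZ/coordsV.
  rewrite !bar_scale cp cq scalar_odd2 pqN scaleN1r opprK !scalerA e1 e2 rmorphV //.
  congr slmx; rewrite invrM ?unitrV // !invrK -mulNr odd1DV ?parN // mulNr opprK.
  exact: par_commr.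
Qed.
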